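(* Let $S^{(1)},S^{(2)}\in\operatorname{Sp}(2n,\mathbb{R})$ with block forms $S^{(p)}=\begin{pmatrix}A^{(p)}&B^{(p)}\\ C^{(p)}&D^{(p)}\end{pmatrix}$, $p=1,2$, such that $D^{(1,2)}=\begin{pmatrix}A^{(1)}&B^{(1)}\\ A^{(2)}&B^{(2)}\end{pmatrix}$ is invertible, and let $$W_\vartheta f(z)=\frac{1}{|\det D^{(1,2)}|}\,W_\sigma f\left((D^{(1,2)})^{-1}z\right),\qquad f\in L^2(\mathbb{R}^n).$$ Then $W_\vartheta$ is a linear perturbation of the Wigner function (i.e. there exist $A\in\operatorname{Gl}(2n,\mathbb{R})$ and a normalization constant $N\in\mathbb{R}$ with $W_\vartheta f=N\,\mathcal{B}_Af$ for all $f\in L^2(\mathbb{R}^n)$) if and only if $S^{(1)},S^{(2)}$ are of the form $$S^{(1)}=\begin{pmatrix}A_{11}^{-1}&0\\ C^{(1)}&A_{11}^T\end{pmatrix},\qquad S^{(2)}=\begin{pmatrix}0&-2A_{22}^T\\ \frac12A_{22}^{-1}&D^{(2)}\end{pmatrix},$$ where $A_{11},A_{22}\in\operatorname{Gl}(n,\mathbb{R})$ and $C^{(1)},D^{(2)}\in\mathbb{R}^{n\times n}$ are such that $(A_{11}^{-1})^TC^{(1)}$ and $A_{22}D^{(2)}$ are symmetric. In that case the linear perturbation is given by $$A=\begin{pmatrix}A_{11}&-A_{22}\\ A_{11}&A_{22}\end{pmatrix}.$$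
   Context: $J=\begin{pmatrix}0&I_n\\ -I_n&0\end{pmatrix}$, and $\operatorname{Sp}(2n,\mathbb{R})$ is the group of real $2n\times2n$ matrices $S$ with $S^TJS=J$. The Wigner function is $W_\sigma f(x,\xi)=\int_{\mathbb{R}^n}f(x+\frac y2)\overline{f(x-\frac y2)}\,e^{-2i\pi\xi\cdot y}\,dy$, $z=(x,\xi)\in\mathbb{R}^{2n}$. The symplectic form is $\vartheta(z,z')=z\cdot\Omega^{-1}z'$ with $\Omega=D^{(1,2)}J(D^{(1,2)})^T$. For $A=\begin{pmatrix}A_{11}&A_{12}\\ A_{21}&A_{22}\end{pmatrix}\in\operatorname{Gl}(2n,\mathbb{R})$ with $n\times n$ blocks, the associated linear perturbation of the Wigner distribution is $$\mathcal{B}_A(f,g)(x,\xi)=\int_{\mathbb{R}^n}f(A_{11}x+A_{12}y)\,\overline{g(A_{21}x+A_{22}y)}\,e^{-2i\pi\xi\cdot y}\,dy,\qquad f,g\in L^2(\mathbb{R}^n),$$ and $\mathcal{B}_Af=\mathcal{B}_A(f,f)$. *)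

(* Defs.v *)
From HB Require Import structures.
From mathcomp Require Import all_boot all_order all_algebra.
From mathcomp Require Import complex.
From mathcomp Require Import all_classical all_reals all_analysis.

Set Implicit Arguments.
Unset Strict Implicit.
Unset Printing Implicit Defensive.

Import Order.TTheory GRing.Theory Num.Theory.
Import numFieldNormedType.Exports.

Local Open Scope classical_set_scope.
Local Open Scope ring_scope.

(* Points of R^n are column vectors.  'cV[R]_n carries the product
   sigma-algebra, generated by the coordinate functions, like the library's
   sigma-algebra on n.-tuple R. *)
Section measurable_cV.
Context {R : realType}.
Variable n : nat.

Definition cV_coord (i : 'I_n) (v : 'cV[R]_n) : R := v i 0.

Let cV_set0 : g_sigma_preimage cV_coord set0.
Proof. exact: sigma_algebra0. Qed.

Let cV_setC A : g_sigma_preimage cV_coord A ->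
  g_sigma_preimage cV_coord (~` A).
Proof. exact: sigma_algebraC. Qed.

Let cV_bigcup (F : (set 'cV[R]_n)^nat) :
  (forall i, g_sigma_preimage cV_coord (F i)) ->
  g_sigma_preimage cV_coord (\bigcup_i (F i)).
Proof. exact: sigma_algebra_bigcup. Qed.

HB.instance Definition _ :=
  @isMeasurable.Build (measure_tuple_display default_measure_display)
    'cV[R]_n (g_sigma_preimage cV_coord) cV_set0 cV_setC cV_bigcup.

End measurable_cV.

Section cV_measurability.
Context {R : realType}.

Lemma measurable_cV_coord n (i : 'I_n) :
  measurable_fun [set: 'cV[R]_n] (@cV_coord R n i).
Proof.
move=> _ Y mY; rewrite setTI; apply: sub_sigma_algebra => /=.
rewrite -bigcup_seq/=; exists i => /=; first by rewrite mem_index_enum.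
by exists Y => //; rewrite setTI.
Qed.

Lemma measurable_fun_cV d (T : measurableType d) n (f : T -> 'cV[R]_n) :
  (forall i, measurable_fun [set: T] (@cV_coord R n i \o f)) ->
  measurable_fun [set: T] f.
Proof.
move=> mf.
suff : g_sigma_preimage (fun i => @cV_coord R n i \o f) `<=` measurable.
  rewrite g_sigma_preimage_comp => prefS _ A mA.
  by apply: prefS; exists A.
apply: smallest_sub; first exact: sigma_algebra_measurable.
rewrite -bigcup_seq; apply: bigcup_sub => i _ A [B mB <-].
exact: mf.
Qed.

Definition cV_cons n (p : measurableTypeR R * 'cV[R]_n) : 'cV[R]_n.+1 :=
  col_mx (p.1%:M : 'M[R]_1) p.2.

Lemma measurable_cV_cons n : measurable_fun setT (@cV_cons n).
Proof.
apply: measurable_fun_cV => i.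
have [[j ji]|[j ji]] : (exists j : 'I_1, i = lshift n j :> 'I_(1 + n)) \/
    (exists j : 'I_n, i = rshift 1 j :> 'I_(1 + n)).
- by case: (@splitP 1 n i) => j ij; [left|right]; exists j; apply/val_inj.
- rewrite (_ : _ \o _ = fst); first exact: measurable_fst.
  apply/funext => p; rewrite /cV_coord /= /cV_cons ji.
  by apply: (etrans (col_mxEu _ _ j 0)); rewrite ord1 mxE eqxx.
- rewrite (_ : _ \o _ = cV_coord j \o snd).
    by apply: measurableT_comp => //; exact: measurable_cV_coord.
  apply/funext => p; rewrite /cV_coord /= /cV_cons ji.
  exact: (col_mxEd _ _ j 0).
Qed.

Definition cV_uncons n (v : 'cV[R]_n.+1) : measurableTypeR R * 'cV[R]_n :=
  (v 0 0, dsubmx (v : 'cV[R]_(1 + n))).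

Lemma cV_consK n : cancel (@cV_cons n) (@cV_uncons n).
Proof.
case=> x v; rewrite /cV_uncons /cV_cons /= col_mxKd; congr pair.
rewrite (_ : (0 : 'I_n.+1) = lshift n (0 : 'I_1)); last exact/val_inj.
by apply: (etrans (col_mxEu _ _ 0 0)); rewrite mxE eqxx.
Qed.

Lemma measurable_cV_uncons n : measurable_fun setT (@cV_uncons n).
Proof.
apply/measurable_fun_pairP; split; first exact: measurable_cV_coord.
apply: measurable_fun_cV => i.
rewrite (_ : _ \o _ = @cV_coord R n.+1 (rshift 1 i)).
  exact: measurable_cV_coord.
by apply/funext => v; rewrite /cV_coord /= mxE.
Qed.

End cV_measurability.

Lemma product_sigma_finite d1 d2 (T1 : measurableType d1)
    (T2 : measurableType d2) (R : realType)
    (m1 : {sigma_finite_measure set T1 -> \bar R})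
    (m2 : {sigma_finite_measure set T2 -> \bar R}) :
  sigma_finite setT (m1 \x m2)%E.
Proof.
have /sigma_finiteP[F [TF ndF Foo]] := sigma_finiteT m1.
have /sigma_finiteP[G [TG ndG Goo]] := sigma_finiteT m2.
exists (fun n => F n `*` G n).
  rewrite -setXTT TF TG predeqE => -[x y]; split.
    move=> [/= [n _ Fnx] [k _ Gky]]; exists (maxn n k) => //; split.
    - by move: x Fnx; exact/subsetPset/ndF/leq_maxl.
    - by move: y Gky; exact/subsetPset/ndG/leq_maxr.
  by move=> [n _ []/= ? ?]; split; exists n.
move=> k; have [? ?] := Foo k; have [? ?] := Goo k.
split; first exact: measurableX.
by rewrite product_measure1E// lte_mul_pinfty// ge0_fin_numE.
Qed.

(* Lebesgue measure on R^(n+1): the image of the product of the Lebesgue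
   measures on R and R^n. *)
Section lebesgue_cV_succ.
Context {R : realType} (n : nat).
Variable m : {sigma_finite_measure set 'cV[R]_n -> \bar R}.

Local Notation lebR := (@lebesgue_measure R).

Definition lebesgue_cV_succ : set 'cV[R]_n.+1 -> \bar R :=
  pushforward (lebR \x m)%E (@cV_cons R n).

Let measurable_preimage A : measurable A -> measurable (@cV_cons R n @^-1` A).
Proof.
by move=> mA; rewrite -[X in measurable X]setTI; exact: measurable_cV_cons.
Qed.

Let succ0 : lebesgue_cV_succ set0 = 0%E.
Proof. by rewrite /lebesgue_cV_succ /pushforward preimage_set0 measure0. Qed.

Let succ_ge0 A : (0 <= lebesgue_cV_succ A)%E.
Proof. by rewrite /lebesgue_cV_succ /pushforward measure_ge0. Qed.

Let succ_sigma_additive : semi_sigma_additive lebesgue_cV_succ.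
Proof.
move=> F mF tF mUF; rewrite /lebesgue_cV_succ /pushforward preimage_bigcup.
apply: measure_semi_sigma_additive.
- by move=> k; exact: measurable_preimage.
- apply/trivIsetP => /= i j _ _ ij; rewrite -preimage_setI.
  by move/trivIsetP : tF => /(_ _ _ _ _ ij) ->//; rewrite preimage_set0.
- by rewrite -preimage_bigcup; exact: measurable_preimage.
Qed.

HB.instance Definition _ := isMeasure.Build _ _ _
  lebesgue_cV_succ succ0 succ_ge0 succ_sigma_additive.

Let succ_sigma_finite : sigma_finite setT lebesgue_cV_succ.
Proof.
have [F FT Foo] := product_sigma_finite lebR m.
exists (fun i => @cV_uncons R n @^-1` F i).
  by rewrite -preimage_bigcup -FT preimage_setT.
move=> i; have [mF Fi] := Foo i; split.
  by rewrite -[X in measurable X]setTI; exact: measurable_cV_uncons.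
rewrite /lebesgue_cV_succ /pushforward -comp_preimage.
rewrite (_ : _ \o _ = id) ?preimage_id//.
by apply/funext => p; exact: cV_consK.
Qed.

HB.instance Definition _ := Measure_isSigmaFinite.Build _ _ _
  lebesgue_cV_succ succ_sigma_finite.

End lebesgue_cV_succ.

Fixpoint lebesgue_cV {R : realType} (n : nat) :
    {sigma_finite_measure set 'cV[R]_n -> \bar R} :=
  if n is n'.+1 then lebesgue_cV_succ (lebesgue_cV n') else dirac (0 : 'cV[R]_0).

Section complex_functions.
Context d (T : measurableType d) (R : realType).
Variable mu : {measure set T -> \bar R}.
Implicit Types f : T -> R[i].

Definition cmeasurable f : Prop :=
  measurable_fun setT (fun t => complex.Re (f t)) /\
  measurable_fun setT (fun t => complex.Im (f t)).

Definition cintegral (D : set T) f : R[i] :=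
  (\int[mu]_(t in D) complex.Re (f t) +i*
   \int[mu]_(t in D) complex.Im (f t))%C.

Definition sqnormc (w : R[i]) : R := complex.Re w ^+ 2 + complex.Im w ^+ 2.

Definition sqL2norm f : \bar R := (\int[mu]_t (sqnormc (f t))%:E)%E.

Definition inL2 f : Prop := cmeasurable f /\ (sqL2norm f < +oo)%E.

End complex_functions.

Section symplectic_wigner.
Context {R : realType} {n : nat}.
Local Notation C := (R[i]).
Local Notation Rn := ('cV[R]_n).
Local Notation R2n := ('cV[R]_(n + n)).
Local Notation leb := (lebesgue_cV (R := R) n).
Local Notation leb2 := (lebesgue_cV (R := R) (n + n)).

Definition Jmx : 'M[R]_(n + n) := block_mx 0 1%:M (- 1%:M) 0.

Definition symplectic (S : 'M[R]_(n + n)) : Prop := S^T *m Jmx *m S = Jmx.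

Definition dotcV (u v : Rn) : R := \sum_(i < n) u i 0 * v i 0.

(* e^{i t} *)
Definition expi (t : R) : C := (cos t +i* sin t)%C.

(* A point z = (x, xi) of R^{2n} is the column x stacked on xi, so that
   x = usubmx z and xi = dsubmx z. *)
Definition wigner (f : Rn -> C) (z : R2n) : C :=
  cintegral leb setT (fun y =>
    f (usubmx z + 2^-1 *: y) * (f (usubmx z - 2^-1 *: y))^*%C *
    expi (- (2 * pi * dotcV (dsubmx z) y))).

Definition D12 (S1 S2 : 'M[R]_(n + n)) : 'M[R]_(n + n) :=
  block_mx (ulsubmx S1) (ursubmx S1) (ulsubmx S2) (ursubmx S2).

Definition wigner_theta (S1 S2 : 'M[R]_(n + n)) (f : Rn -> C) (z : R2n) : C :=
  (`|\det (D12 S1 S2)|^-1)%:C%C * wigner f (invmx (D12 S1 S2) *m z).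

(* For f, g in L^2 and a general invertible A, the function
   y |-> f(A11 x + A12 y) conj(g(A21 x + A22 y)) is, for almost every x, in
   L^2 but in general not in L^1: the Fourier integral over y defining
   B_A(f, g) is an L^2-Fourier transform, i.e. the limit in L^2(R^{2n}) of the
   absolutely convergent integrals over the cubes [-k, k]^n.  It agrees with
   the Lebesgue integral whenever the latter converges absolutely. *)
Definition cube (k : nat) : set Rn := [set y | forall i, `|y i 0| <= k%:R].

Definition BA_truncated (A : 'M[R]_(n + n)) (f g : Rn -> C) (k : nat)
    (z : R2n) : C :=
  cintegral leb (cube k) (fun y =>
    f (ulsubmx A *m usubmx z + ursubmx A *m y) *
    (g (dlsubmx A *m usubmx z + drsubmx A *m y))^*%C *
    expi (- (2 * pi * dotcV (dsubmx z) y))).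

(* F is (a representative of the L^2-class of) B_A(f, g) *)
Definition is_BA (A : 'M[R]_(n + n)) (f g : Rn -> C) (F : R2n -> C) : Prop :=
  cmeasurable F /\
  (fun k => sqL2norm leb2 (fun z => F z - BA_truncated A f g k z)) @ \oo
    --> 0%E.

(* W f = N B_A(f, f) in L^2(R^{2n}), for all f in L^2(R^n) *)
Definition linear_perturbation_by (W : (Rn -> C) -> R2n -> C)
    (A : 'M[R]_(n + n)) : Prop :=
  A \in unitmx /\
  exists N : R, forall f : Rn -> C, inL2 leb f ->
    exists2 F, is_BA A f f F & {ae leb2, forall z, W f z = N%:C%C * F z}.

Definition is_linear_perturbation (W : (Rn -> C) -> R2n -> C) : Prop :=
  exists A, linear_perturbation_by W A.

Definition perturbation_form (S1 S2 : 'M[R]_(n + n))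
    (A11 A22 C1 D2 : 'M[R]_n) : Prop :=
  [/\ A11 \in unitmx /\ A22 \in unitmx,
      ((invmx A11)^T *m C1)^T = (invmx A11)^T *m C1,
      (A22 *m D2)^T = A22 *m D2,
      S1 = block_mx (invmx A11) 0 C1 A11^T
    & S2 = block_mx 0 (- 2 *: A22^T) (2^-1 *: invmx A22) D2].

End symplectic_wigner.

(* Main.v *)
(* Both implications rest on a Plancherel inequality |F h|_2 <= |h|_2 for
   integrable h.  It bounds, in L^2(R^{2n}), the error made by truncating the
   integral defining B_A f to a cube, for an A whose blocks A12 and A22 are
   invertible; so for S1, S2 of the stated form B_A f is the absolutely
   convergent integral, and the substitution y -> -2 A22 y turns W_theta f into
   |det A11| B_A f.

   Conversely, let W_theta = N B_A, let f be the indicator of a cube, and write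
   g = |W f|^2, an integrable function that is positive near 0.  Two symmetries
   already hold for the truncated integrals, up to unimodular factors and complex
   conjugation, and pass to |B_A f| in the limit.
   - Modulating f by eta translates W f by (0, eta) and |B_A f| by (0, K eta).
     Hence g is invariant under translation by D^{-1}(0, K eta) - (0, eta),
     where D = D^{(1,2)}; an integrable function has no period, so
     D (0, eta) = (0, K eta), i.e. B1 eta = 0.
   - As f is real, |B_A f| and g are even in the frequency variable.  Hence g is
     invariant under D^{-1} sigma D sigma, sigma = diag(1, -1), which for B1 = 0
     is a shear with parameter a multiple of B2^{-1} A2; again g can only be
     invariant under the trivial shear, so A2 = 0.
   Symplecticity then gives the remaining blocks. *)

Require Import Defs.
From HB Require Import structures.
From mathcomp Require Import all_boot all_order all_algebra.
From mathcomp Require Import complex ring lra.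
From mathcomp Require Import all_classical all_reals all_analysis measurable_realfun.
Set Implicit Arguments.
Unset Strict Implicit.
Unset Printing Implicit Defensive.
Import Order.TTheory GRing.Theory Num.Theory.
Import numFieldNormedType.Exports.
Local Open Scope classical_set_scope.
Local Open Scope ring_scope.

(** * Linear changes of variables for the Lebesgue measure on R^n *)

(** In the converse the blocks A12 and A22 of the unknown A may be singular, and then B_A f has no
    integral formula: it is known only as an L^2 limit. Its symmetries are therefore proved for the
    truncated integrals, which converge absolutely for every A once f is bounded. Only moduli are
    carried to the limit, because taking the modulus does not increase L^2 distances and discards
    the phases that the symmetries introduce. The constant N multiplies both sides of every identity
    between moduli, so it is never divided by and N = 0 needs no separate case. Identities then hold
    only almost everywhere, which is why they are refuted by integrals over boxes and not at points.
    An inequality of Plancherel type is enough, since it serves only to show that truncation errors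
    vanish and that g is integrable. Its proof uses the weight exp(-e (|x_1| + ... + |x_n|)), whose
    Fourier transform is a product of explicit one-dimensional kernels, so that all integrals reduce
    to elementary antiderivatives. Since Lebesgue measure on R^n is built one coordinate at a time,
    linear substitutions are obtained by block elimination. *)

Section affine_change_of_variable_1d.
Context {R : realType}.
Local Notation mu := (@lebesgue_measure R).
Local Open Scope ereal_scope.

Lemma measurable_affine1 (a b : R) :
  measurable_fun setT ((fun x => a * x + b)%R : measurableTypeR R -> measurableTypeR R).
Proof.
by apply: measurable_funD => //; exact: measurable_funM.
Qed.

(** For a > 0, Lebesgue measure equals a times its image under x -> a x + b, because the two agree
    on the intervals ]u, v]; the formula is then the integration rule for image measures. *)
Let pos_affine (a b : R) (f : measurableTypeR R -> \bar R) : (0 < a)%R ->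
  measurable_fun setT f -> (forall x, 0 <= f x) ->
  \int[mu]_x f (a * x + b)%R = (`|a|^-1)%:E * \int[mu]_x f x.
Proof.
move=> a0 mf f0.
have ai0 : (0 <= `|a|)%R by [].
pose phi := (fun x => a * x + b)%R : measurableTypeR R -> measurableTypeR R.
pose m' : {measure set (measurableTypeR R) -> \bar R} :=
  mscale (NngNum ai0) (pushforward mu phi).
pose m := m' (measurable_affine1 a b).
have mE A : measurable A -> mu A = m A.
  move=> mA; apply: lebesgue_measure_unique => // _ [[u v]] _ <-.
  transitivity (`|a|%:E * mu (phi @^-1` `]u, v])); last by [].
  rewrite (_ : _ @^-1` _ = `](u - b) / a, (v - b) / a]%classic)%R; last first.
    apply/seteqP; split => x /=; rewrite !in_itv/= ltr_pdivrMr// ler_pdivlMr//;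
      by rewrite ltrBlDr lerBrDr mulrC.
  rewrite !lebesgue_measure_itv/= !lte_fin ltr_pM2r ?invr_gt0// ltrD2r.
  case: ifPn => // uv; last by rewrite mule0.
  rewrite -!EFinD -EFinM; congr EFin.
  by rewrite -mulrBl opprD addrACA subrr addr0 gtr0_norm// mulrC divfK// gt_eqF.
have -> : \int[mu]_x f x = \int[m]_x f x.
  by apply: eq_measure_integral => A mA _; exact: mE.
rewrite ge0_integral_mscale// muleA -EFinM/= mulVf ?normr_eq0 ?gt_eqF// mul1e.
by rewrite ge0_integral_pushforward//; exact: measurable_affine1.
Qed.

Lemma ge0_integral_affine1 (a b : R) (f : measurableTypeR R -> \bar R) :
  a != 0%R -> measurable_fun setT f -> (forall x, 0 <= f x) ->
  \int[mu]_x f (a * x + b)%R = (`|a|^-1)%:E * \int[mu]_x f x.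
Proof.
move=> a0 mf f0; have [ap|an|/eqP] := ltgtP 0%R a; last 2 first.
(* A negative slope is reduced to the positive slope -a by the invariance of Lebesgue measure under
   reflection. *)
- pose g x := f (- a * x + b)%R.
  have mg : measurable_fun setT g.
    apply: (@measurableT_comp _ _ _ _ _ _ f) => //.
    exact: (measurable_affine1 (- a) b).
  have <- : \int[mu]_x g x = (`|a|^-1)%:E * \int[mu]_x f x.
    by rewrite -(normrN a) pos_affine// oppr_gt0.
  transitivity (\int[pushforward mu (-%R : _ -> measurableTypeR R)]_x g x).
    rewrite ge0_integral_pushforward//.
      by apply: eq_integral => x _; rewrite /g /= mulrNN.
    by move=> x _; exact: f0.
  apply: eq_measure_integral => A mA _; exact: lebesgue_measureN.
- by rewrite eq_sym (negbTE a0).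
- exact: pos_affine.
Qed.

End affine_change_of_variable_1d.

(** * Coordinates, measurability and Tonelli's theorem on R^n *)

Section lebesgue_cV_theory.
Context {R : realType}.
Local Notation leb n := (lebesgue_cV (R := R) n).
Local Notation mu1 := (@lebesgue_measure R).
Local Open Scope ereal_scope.

Lemma cV_cons0 n (p : measurableTypeR R * 'cV[R]_n) : cV_cons p 0%R 0%R = p.1.
Proof.
rewrite (_ : (0 : 'I_n.+1)%R = lshift n (0 : 'I_1)%R); last exact/val_inj.
by rewrite /cV_cons; apply: (etrans (col_mxEu _ _ 0%R 0%R)); rewrite mxE eqxx.
Qed.

Lemma cV_consS n (p : measurableTypeR R * 'cV[R]_n) i :
  cV_cons p (lift ord0 i) 0%R = p.2 i 0%R.
Proof. by rewrite -rshift1 /cV_cons; exact: (col_mxEd _ _ i 0%R). Qed.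

Lemma cV_consE n (v : 'cV[R]_n.+1) :
  v = cV_cons (v 0%R 0%R, \col_i v (lift ord0 i) 0%R).
Proof.
apply/colP => i; case: (unliftP ord0 i) => [j ->|->].
  by rewrite cV_consS mxE.
by rewrite cV_cons0.
Qed.

Section measurability.
Context d (T : measurableType d).

Lemma measurable_cV_entry n (f : T -> 'cV[R]_n) i :
  measurable_fun setT f -> measurable_fun setT (fun t => f t i 0%R : R).
Proof.
move=> mf; apply: (@measurableT_comp _ _ _ _ _ _ (@cV_coord R n i)) => //.
exact: measurable_cV_coord.
Qed.

Lemma measurable_cV_add n (f g : T -> 'cV[R]_n) :
  measurable_fun setT f -> measurable_fun setT g ->
  measurable_fun setT (fun t => f t + g t)%R.
Proof.
move=> mf mg; apply: measurable_fun_cV => i.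
rewrite (_ : _ \o _ = (fun t => f t i 0 + g t i 0)%R).
  by apply: measurable_funD; exact: measurable_cV_entry.
by apply/funext => t; rewrite /= /cV_coord mxE.
Qed.

Lemma measurable_cV_mul m n (M : 'M[R]_(m, n)) (f : T -> 'cV[R]_n) :
  measurable_fun setT f -> measurable_fun setT (fun t => M *m f t)%R.
Proof.
move=> mf; apply: measurable_fun_cV => i.
rewrite (_ : _ \o _ = (fun t => \sum_j M i j * f t j 0)%R).
  apply: measurable_sum => j; apply: measurable_funM => //.
  exact: measurable_cV_entry.
by apply/funext => t; rewrite /= /cV_coord mxE.
Qed.

Lemma measurable_cV_affine m n (M : 'M[R]_(m, n)) b (f : T -> 'cV[R]_n) :
  measurable_fun setT f -> measurable_fun setT (fun t => M *m f t + b)%R.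
Proof.
by move=> mf; apply: measurable_cV_add => //; exact: measurable_cV_mul.
Qed.

Lemma measurable_cV_col m n (f : T -> 'cV[R]_m) (g : T -> 'cV[R]_n) :
  measurable_fun setT f -> measurable_fun setT g ->
  measurable_fun setT (fun t => col_mx (f t) (g t)).
Proof.
move=> mf mg; apply: measurable_fun_cV => i.
case: (split_ordP i) => j ->.
  rewrite (_ : _ \o _ = (fun t => f t j 0%R)); first exact: measurable_cV_entry.
  by apply/funext => t; rewrite /= /cV_coord col_mxEu.
rewrite (_ : _ \o _ = (fun t => g t j 0%R)); first exact: measurable_cV_entry.
by apply/funext => t; rewrite /= /cV_coord col_mxEd.
Qed.

Lemma measurable_cV_usubmx m n (f : T -> 'cV[R]_(m + n)) :
  measurable_fun setT f -> measurable_fun setT (fun t => usubmx (f t)).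
Proof.
move=> mf; apply: measurable_fun_cV => i.
rewrite (_ : _ \o _ = (fun t => f t (lshift n i) 0%R)).
  exact: measurable_cV_entry.
by apply/funext => t; rewrite /= /cV_coord mxE.
Qed.

Lemma measurable_cV_dsubmx m n (f : T -> 'cV[R]_(m + n)) :
  measurable_fun setT f -> measurable_fun setT (fun t => dsubmx (f t)).
Proof.
move=> mf; apply: measurable_fun_cV => i.
rewrite (_ : _ \o _ = (fun t => f t (rshift m i) 0%R)).
  exact: measurable_cV_entry.
by apply/funext => t; rewrite /= /cV_coord mxE.
Qed.

Lemma measurable_cV_cons_comp n (f : T -> measurableTypeR R) (g : T -> 'cV[R]_n) :
  measurable_fun setT f -> measurable_fun setT g ->
  measurable_fun setT (fun t => cV_cons (f t, g t)).
Proof.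
move=> mf mg.
exact: (measurableT_comp (@measurable_cV_cons R n) (measurable_fun_pair mf mg)).
Qed.

Lemma measurable_dotcV n (f g : T -> 'cV[R]_n) :
  measurable_fun setT f -> measurable_fun setT g ->
  measurable_fun setT (fun t => dotcV (f t) (g t)).
Proof.
move=> mf mg; apply: measurable_sum => i.
by apply: measurable_funM; exact: measurable_cV_entry.
Qed.

End measurability.

Lemma ge0_integral_cV0 (f : 'cV[R]_0 -> \bar R) :
  measurable_fun setT f -> (forall v, 0 <= f v) ->
  \int[leb 0]_v f v = f 0%R.
Proof.
move=> mf f0; rewrite /= integral_dirac//.
by rewrite diracT mul1e.
Qed.

Lemma integral_cV_succ n (f : 'cV[R]_n.+1 -> \bar R) :
  measurable_fun setT f -> (forall v, 0 <= f v) ->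
  \int[leb n.+1]_v f v = \int[mu1 \x leb n]_p f (cV_cons p).
Proof.
move=> mf f0.
rewrite /= /lebesgue_cV_succ ge0_integral_pushforward//.
exact: measurable_cV_cons.
Qed.

Lemma tonelli_cV_succ n (f : 'cV[R]_n.+1 -> \bar R) :
  measurable_fun setT f -> (forall v, 0 <= f v) ->
  \int[leb n.+1]_v f v = \int[mu1]_t \int[leb n]_v f (cV_cons (t, v)).
Proof.
move=> mf f0; rewrite integral_cV_succ// fubini_tonelli1//.
by apply: measurableT_comp => //; exact: measurable_cV_cons.
Qed.

Lemma tonelli_cV_succ_rev n (f : 'cV[R]_n.+1 -> \bar R) :
  measurable_fun setT f -> (forall v, 0 <= f v) ->
  \int[leb n.+1]_v f v = \int[leb n]_v \int[mu1]_t f (cV_cons (t, v)).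
Proof.
move=> mf f0; rewrite integral_cV_succ// fubini_tonelli2//.
by apply: measurableT_comp => //; exact: measurable_cV_cons.
Qed.

Lemma measurable_tonelli_cV_succ n (f : 'cV[R]_n.+1 -> \bar R) :
  measurable_fun setT f -> (forall v, 0 <= f v) ->
  measurable_fun setT (fun t : measurableTypeR R => \int[leb n]_v f (cV_cons (t, v))).
Proof.
move=> mf f0.
apply: (measurable_fun_fubini_tonelli_F (fun p => f (cV_cons p))) => //.
by apply: measurableT_comp => //; exact: measurable_cV_cons.
Qed.

(** [m.+1 + n] and [(m + n).+1] are convertible, so prepending a coordinate commutes with stacking.
    This lets the measure on R^(m+n), defined coordinate by coordinate, be split into the variables
    x and xi. *)
Lemma col_mx_cV_cons m n t (x : 'cV[R]_m) (y : 'cV[R]_n) :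
  col_mx (cV_cons (t, x)) y = cV_cons (t, col_mx x y) :> 'cV[R]_(m.+1 + n).
Proof.
apply/colP => i; case: (split_ordP i) => j ->.
  rewrite col_mxEu; case: (unliftP ord0 j) => [k ->|->].
    rewrite cV_consS /= (_ : lshift n (lift ord0 k) = lift ord0 (lshift n k));
      last exact/val_inj.
    by rewrite cV_consS /= col_mxEu.
  rewrite cV_cons0 (_ : lshift n ord0 = 0%R); last exact/val_inj.
  by rewrite cV_cons0.
rewrite col_mxEd (_ : rshift m.+1 j = lift ord0 (rshift m j)); last exact/val_inj.
by rewrite cV_consS /= col_mxEd.
Qed.

Lemma tonelli_cV_add m n (f : 'cV[R]_(m + n) -> \bar R) :
  measurable_fun setT f -> (forall v, 0 <= f v) ->
  \int[leb (m + n)]_z f z = \int[leb m]_x \int[leb n]_y f (col_mx x y).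
Proof.
elim: m f => [|m IH] f mf f0.
  rewrite ge0_integral_cV0.
  - apply: eq_integral => y _; congr f; apply/colP => i.
    rewrite (_ : i = rshift 0 i) ?col_mxEd; last exact/val_inj.
    by congr (y _ _); exact/val_inj.
  - apply: (measurable_fun_fubini_tonelli_F (fun p => f (col_mx p.1 p.2))) => //.
    by apply: measurableT_comp => //; apply: measurable_cV_col.
  - by move=> x; exact: integral_ge0.
have mF : measurable_fun setT (fun x => \int[leb n]_y f (col_mx x y)).
  apply: (measurable_fun_fubini_tonelli_F (fun p => f (col_mx p.1 p.2))) => //.
  by apply: measurableT_comp => //; apply: measurable_cV_col.
rewrite [RHS]tonelli_cV_succ//; last first.
  by move=> x; exact: integral_ge0.
rewrite (@tonelli_cV_succ (m + n) f mf f0).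
apply: eq_integral => t _; rewrite IH; last 2 first.
- by apply: measurableT_comp => //; exact: measurable_cV_cons_comp.
- by move=> v; exact: f0.
by apply: eq_integral => x _; apply: eq_integral => y _; rewrite col_mx_cV_cons.
Qed.

End lebesgue_cV_theory.

(** * Change of variables under invertible affine maps of R^n *)

Section linear_change_of_variables.
Context {R : realType}.
Local Notation leb n := (lebesgue_cV (R := R) n).
Local Notation mu1 := (@lebesgue_measure R).

Lemma ge0_integral_cV_translate n (c : 'cV[R]_n) (f : 'cV[R]_n -> \bar R) :
  measurable_fun setT f -> (forall v, 0 <= f v)%E ->
  (\int[leb n]_v f (v + c)%R = \int[leb n]_v f v)%E.
Proof.
elim: n c f => [|n IH] c f mf f0.
  by congr integral; apply/funext => v; congr f; apply/colP; case.
have mfc : measurable_fun setT (fun v : 'cV[R]_n.+1 => f (v + c)).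
  by apply: measurableT_comp => //; exact: measurable_cV_add.
rewrite (tonelli_cV_succ mfc (fun v => f0 (v + c))) (tonelli_cV_succ mf f0).
pose c' := \col_i c (lift ord0 i) 0.
have ce t v : cV_cons (t, v) + c = cV_cons (t + c 0 0, v + c').
  apply/colP => i; rewrite mxE; case: (unliftP ord0 i) => [j ->|->].
    by rewrite !cV_consS/= !mxE.
  by rewrite !cV_cons0.
transitivity (\int[mu1]_t \int[leb n]_v f (cV_cons (1 * t + c 0%R 0%R, v))%R)%E.
  apply: eq_integral => t _; rewrite mul1r.
  under eq_integral do rewrite ce.
  apply: (IH c' (fun v => f (cV_cons (t + c 0%R 0%R, v))%R)) => //.
  apply: measurableT_comp => //; exact: measurable_cV_cons_comp.
rewrite (@ge0_integral_affine1 _ _ _ (fun t => \int[leb n]_v f (cV_cons (t, v)))%E) //.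
- by rewrite normr1 invr1 mul1e.
- exact: measurable_tonelli_cV_succ.
- by move=> t; exact: integral_ge0.
Qed.

Local Opaque lebesgue_cV.

(** The substitution formula as a property of the matrix: it is stable under products, hence needs
    checking only on the factors of an elimination. *)
Let scales n (M : 'M[R]_n) := forall f : 'cV[R]_n -> \bar R,
  measurable_fun setT f -> (forall v, 0 <= f v)%E ->
  (\int[leb n]_v f (M *m v) = (`|\det M|^-1)%:E * \int[leb n]_v f v)%E.

Let scalesM n (M N : 'M[R]_n) : scales M -> scales N -> scales (M *m N).
Proof.
move=> sM sN f mf f0.
under eq_integral do rewrite -mulmxA.
rewrite (sN (fun v => f (M *m v)))//; last first.
  by apply: measurableT_comp => //; exact: measurable_cV_mul.
by rewrite sM// muleA -EFinM det_mulmx normrM invfM mulrC.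
Qed.

(** For a fixed first coordinate t, the shear translates the remaining coordinates by t v, so the
    inner integral does not change. *)
Let lower_shear n (v : 'cV[R]_n) : scales (block_mx 1%:M 0 v 1%:M : 'M[R]_(1 + n)).
Proof.
move=> f mf f0; rewrite det_lblock !det1 mulr1 normr1 invr1 mul1e.
rewrite tonelli_cV_succ; [|exact: (measurableT_comp mf (measurable_cV_mul _ _))|by []].
rewrite (tonelli_cV_succ mf f0); apply: eq_integral => t _.
transitivity (\int[leb n]_x f (cV_cons (t, x + t *: v)%R))%E.
  apply: eq_integral => x _; congr f.
  rewrite /cV_cons/= mul_block_col mul1mx mul0mx addr0 mul1mx mul_mx_scalar.
  by rewrite addrC.
apply: (ge0_integral_cV_translate _ (f := fun x => f (cV_cons (t, x)))) => //.
by apply: measurableT_comp => //; exact: measurable_cV_cons_comp.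
Qed.

(** Here the first coordinate is integrated innermost: for fixed remaining coordinates it undergoes
    the one-dimensional affine map t -> a t + b x, and the outer variable is then transformed by
    S. *)
Let upper_block n (a : R) (b : 'rV[R]_n) (S : 'M[R]_n) : a != 0 -> scales S ->
  scales (block_mx a%:M b 0 S : 'M[R]_(1 + n)).
Proof.
move=> a0 sS f mf f0; rewrite det_ublock det_scalar1 normrM invfM.
rewrite tonelli_cV_succ_rev; [|exact: (measurableT_comp mf (measurable_cV_mul _ _))|by []].
rewrite (tonelli_cV_succ_rev mf f0).
have mfc (x : 'cV[R]_n) :
    measurable_fun setT (fun t : measurableTypeR R => f (cV_cons (t, x))).
  by apply: measurableT_comp => //; exact: measurable_cV_cons_comp.
have mF : measurable_fun setT
    (fun x : 'cV[R]_n => \int[mu1]_t f (cV_cons (t, x)))%E.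
  apply: (measurable_fun_fubini_tonelli_G (fun p => f (cV_cons p))) => //.
  by apply: measurableT_comp => //; exact: measurable_cV_cons.
transitivity (\int[leb n]_x
    ((`|a|^-1)%:E * \int[mu1]_t f (cV_cons (t, S *m x)%R)))%E.
  apply: eq_integral => x _.
  rewrite -(@ge0_integral_affine1 _ a ((b *m x) 0 0)
    (fun t => f (cV_cons (t, S *m x))))//.
  apply: eq_integral => t _; congr f.
  rewrite /cV_cons/= mul_block_col mul0mx add0r; congr col_mx.
  by apply/matrixP => i j; rewrite !ord1 -scalar_mxM !mxE eqxx.
rewrite ge0_integralZl_EFin; [|by []| | |by rewrite invr_ge0]; last 2 first.
- by move=> x _; exact: integral_ge0.
- by apply: (measurableT_comp mF); exact: measurable_cV_mul.
rewrite (sS (fun x => \int[mu1]_t f (cV_cons (t, x)))%E mF); last first.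
  by move=> x; exact: integral_ge0.
by rewrite muleA -EFinM.
Qed.

Let scales1 n : scales (1%:M : 'M[R]_n).
Proof.
move=> f mf f0; rewrite det1 normr1 invr1 mul1e.
by apply: eq_integral => v _; rewrite mul1mx.
Qed.

(** One step of Gaussian elimination. The nonzero pivot a splits off a lower shear and leaves its
    Schur complement, which is invertible because determinants multiply. *)
Let scales_unit_corner n (a : R) b c (D : 'M[R]_n) : a != 0 ->
  (forall S : 'M[R]_n, S \in unitmx -> scales S) ->
  block_mx a%:M b c D \in unitmx -> scales (block_mx a%:M b c D : 'M[R]_(1 + n)).
Proof.
move=> a0 IH Mu.
have ME : block_mx a%:M b c D = block_mx 1%:M 0 (a^-1 *: c) 1%:M *m
    block_mx a%:M b 0 (D - a^-1 *: c *m b) :> 'M[R]_(1 + n).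
  rewrite mulmx_block !mul1mx !mul0mx !addr0.
  rewrite mul_mx_scalar scalerA divff// scale1r.
  by rewrite [in RHS]addrC subrK.
move: Mu; rewrite ME => Mu; apply: scalesM; first exact: lower_shear.
apply: upper_block => //; apply: IH.
move: Mu; rewrite unitmxE det_mulmx det_lblock !det1 !mul1r det_ublock.
by rewrite unitrM -unitmxE => /andP[].
Qed.

(* A unit matrix with zero corner entry gets a nonzero one by adding some other
   row to the first, so block elimination applies. *)
Lemma ge0_integral_cV_linear n (M : 'M[R]_n) (f : 'cV[R]_n -> \bar R) :
  M \in unitmx -> measurable_fun setT f -> (forall v, 0 <= f v)%E ->
  (\int[leb n]_v f (M *m v) = (`|\det M|^-1)%:E * \int[leb n]_v f v)%E.
Proof.
suff : M \in unitmx -> scales M by move=> + Mu; apply.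
elim: n M {f} => [M _|n IH].
  rewrite (_ : M = 1%:M); first exact: scales1.
  by apply/matrixP; case.
rewrite -[n.+1]/(1 + n)%N => M; rewrite -[M]submxK.
set A := ulsubmx _; set b := ursubmx _; set c := dlsubmx _; set D := drsubmx _.
rewrite [A]mx11_scalar; move: A b c D => A b c D.
have [A0|A0] := eqVneq (A 0 0) 0; last exact: scales_unit_corner.
move=> Mu; have [i ci] : exists i, c i 0 != 0.
  apply: contrapT => /forallNP c0; move: Mu.
  rewrite (_ : c = 0) ?unitmxE ?det_ublock ?A0 ?det_scalar1 ?mul0r ?unitr0//.
  by apply/matrixP => i j; rewrite !ord1 mxE; apply/eqP/negPn/negP/c0.
pose U (s : R) : 'M[R]_(1 + n) := block_mx 1%:M (s *: delta_mx 0 i) 0 1%:M.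
have UM s : U s *m block_mx (A 0 0)%:M b c D =
    block_mx (A 0 0 + s * c i 0)%:M (b + s *: row i D) c D.
  rewrite mulmx_block !mul1mx !mul0mx !add0r -!scalemxAl -!rowE; congr block_mx.
  apply/matrixP => k l; by rewrite !ord1 !mxE eqxx !mulr1n.
have UK : U (-1) *m U 1 = 1%:M.
  rewrite /U mulmx_block !mul1mx !mulmx1 !mulmx0 !mul0mx !add0r !addr0 !scaleN1r.
  by rewrite scale1r subrr -scalar_mx_block.
rewrite -[block_mx _ _ _ _]mul1mx -UK -mulmxA UM; apply: scalesM.
  by apply: upper_block; [exact: oner_neq0|exact: scales1].
apply: scales_unit_corner => //; first by rewrite A0 add0r mul1r.
rewrite -UM unitmx_mul Mu andbT.
by case/mulmx1_unit: UK.
Qed.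

Lemma ge0_integral_cV_affine n (M : 'M[R]_n) c (f : 'cV[R]_n -> \bar R) :
  M \in unitmx -> measurable_fun setT f -> (forall v, 0 <= f v)%E ->
  (\int[leb n]_v f (M *m v + c)%R = (`|\det M|^-1)%:E * \int[leb n]_v f v)%E.
Proof.
move=> Mu mf f0.
rewrite (ge0_integral_cV_linear (f := fun v => f (v + c))%R Mu)//.
  by rewrite ge0_integral_cV_translate.
by apply: measurableT_comp => //; exact: measurable_cV_add.
Qed.

Lemma integrable_cV_affine n (M : 'M[R]_n) c (f : 'cV[R]_n -> \bar R) :
  M \in unitmx -> (leb n).-integrable setT f ->
  (leb n).-integrable setT (fun v => f (M *m v + c)).
Proof.
move=> Mu /integrableP[mf fi].
have mA : measurable_fun setT (fun v : 'cV[R]_n => M *m v + c).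
  exact: measurable_cV_affine.
apply/integrableP; split; first exact: (measurableT_comp mf mA).
rewrite (ge0_integral_cV_affine c (f := fun v => `|f v|)%E)//.
  by rewrite lte_mul_pinfty// lee_fin invr_ge0.
by apply: measurableT_comp.
Qed.

Lemma integral_cV_affine n (M : 'M[R]_n) c (f : 'cV[R]_n -> \bar R) :
  M \in unitmx -> (leb n).-integrable setT f ->
  (\int[leb n]_v f (M *m v + c)%R = (`|\det M|^-1)%:E * \int[leb n]_v f v)%E.
Proof.
move=> Mu fi; have /integrableP[mf _] := fi.
rewrite integralE [in RHS]integralE muleBr; [|by []|]; last first.
  exact: integrable_add_def.
rewrite -(ge0_integral_cV_affine c Mu (measurable_funepos mf))//.
rewrite -(ge0_integral_cV_affine c Mu (measurable_funeneg mf))//.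
by congr (_ - _)%E; apply: eq_integral => v _; rewrite !(funeposE, funenegE).
Qed.

Lemma ae_cV_affine n (M : 'M[R]_n) c (P : 'cV[R]_n -> Prop) :
  M \in unitmx -> {ae leb n, forall v, P v} ->
  {ae leb n, forall v, P (M *m v + c)}.
Proof.
move=> Mu [N [mN N0 PN]].
have mA : measurable_fun setT (fun v : 'cV[R]_n => M *m v + c).
  exact: measurable_cV_affine.
exists ((fun v => M *m v + c) @^-1` N); split.
- by rewrite -[X in measurable X]setTI; exact: mA.
- have mpN : measurable ((fun v => M *m v + c) @^-1` N).
    by rewrite -[X in measurable X]setTI; exact: mA.
  transitivity (\int[leb n]_v (\1_N (M *m v + c) : R)%:E)%E.
    by rewrite -[X in leb n X]setIT -integral_indic.
  rewrite (ge0_integral_cV_affine c (f := fun v => (\1_N v : R)%:E))//.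
    rewrite integral_indic// setIT.
    by apply: etrans (mule0 _); congr (_ * _)%E; exact: N0.
  by apply/measurable_EFinP; exact: measurable_indic.
- by move=> v /= nP; exact: PN.
Qed.

End linear_change_of_variables.

(** * The Plancherel inequality *)

Section laplace_kernel_1d.
Context {R : realType}.
Local Notation mu1 := (@lebesgue_measure R).
Implicit Types e a x : R.

Lemma is_derive1_continuous (f df : R -> R) :
  (forall x, is_derive x 1 f (df x)) -> continuous f.
Proof.
move=> fdf x; apply: differentiable_continuous.
by apply/derivable1_diffP; case: (fdf x).
Qed.

Lemma ge0_integral0y_FTC (f F : R -> R) (l : R) :
  (forall x, 0 <= f x) -> continuous f ->
  (forall x, is_derive x 1 F (f x)) -> F x @[x --> +oo] --> l ->
  (\int[mu1]_(x in `[0%R, +oo[) (f x)%:E = (l - F 0)%:E)%E.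
Proof.
move=> f0 cf FF Fl; rewrite (@ge0_continuous_FTC2y _ f F 0 l)//.
- exact: continuous_subspaceT.
- by apply: cvg_at_right_filter; exact: (is_derive1_continuous FF).
- by move=> x _; rewrite derive1E; case: (FF x).
Qed.

Definition laplace e x := expR (- e * `|x|).

(** The Fourier transform of [laplace e] at angular frequency a. Up to scaling it is 1 / (1 + x^2),
    whose integral is pi. *)
Definition cauchy e a := 2 * e / (e ^+ 2 + a ^+ 2).

Lemma laplace_ge0 e x : 0 <= laplace e x. Proof. exact: expR_ge0. Qed.

Lemma continuous_laplace e : continuous (laplace e).
Proof.
move=> x; apply: continuous_comp; last exact: continuous_expR.
apply: (@continuousM _ R^o (fun=> - e) (fun x => `|x|)).
  exact: cst_continuous.
exact: norm_continuous.
Qed.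

Lemma expRNM_cvgy e : 0 < e -> expR (- e * x) @[x --> +oo] --> 0.
Proof.
move=> e0.
rewrite (_ : (fun x => expR (- e * x)) =
             (fun z => expR (- z)) \o (fun z => e * z)); last first.
  by apply: eq_fun => x; rewrite mulNr.
apply: (@cvg_comp _ _ _ _ _ _ (pinfty_nbhs R)); last exact: cvgr_expR.
exact: gt0_cvgMry.
Qed.

Lemma sqr_add_gt0 e a : 0 < e -> 0 < e ^+ 2 + a ^+ 2.
Proof. by move=> e0; rewrite ltr_wpDr ?sqr_ge0 ?exprn_gt0. Qed.

(** The summand 1 keeps the integrand nonnegative, so that the fundamental theorem of calculus on a
    half-line applies with the explicit antiderivative [F]. The cosine transform is recovered later
    by subtracting the mass of [laplace e]. *)
Let ftc_laplace e a : 0 < e ->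
  (\int[mu1]_(x in `[0%R, +oo[) (expR (- e * x) * (1 + cos (a * x)))%:E =
   (e^-1 + e / (e ^+ 2 + a ^+ 2))%:E)%E.
Proof.
move=> e0; have d0 := sqr_add_gt0 a e0.
pose F x := - e^-1 * expR (- e * x) +
  (e ^+ 2 + a ^+ 2)^-1 * (expR (- e * x) * (a * sin (a * x) - e * cos (a * x))).
have c0 : expR (- e * x) * (a * sin (a * x) - e * cos (a * x)) @[x --> +oo] --> 0.
  have bnd x : `|a * sin (a * x) - e * cos (a * x)| <= `|a| + e.
    rewrite (le_trans (ler_normB _ _))// !normrM (gtr0_norm e0) lerD//.
      by apply: ler_piMr; rewrite ?normr_ge0 ?ler_norml ?sin_geN1 ?sin_le1.
    by apply: ler_piMr; rewrite ?(ltW e0) ?ler_norml ?cos_geN1 ?cos_le1.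
  have lim (k : R) : k * expR (- e * x) @[x --> +oo] --> 0.
    by rewrite -(mulr0 k); apply: cvgMl_tmp; exact: expRNM_cvgy.
  apply: (squeeze_cvgr _ (lim (- (`|a| + e))) (lim (`|a| + e))).
  near=> x; rewrite mulNr [_ * expR _]mulrC -mulrN !ler_pM2l ?expR_gt0//.
  by rewrite -ler_norml.
have FF x : is_derive x 1 F (expR (- e * x) * (1 + cos (a * x))).
  apply: is_derive_eq; rewrite /GRing.scale /=; field.
  by rewrite !gt_eqF.
rewrite (ge0_integral0y_FTC _ _ FF (l := 0)).
- rewrite /F !mulr0 expR0 sin0 cos0 !mulr1 mulr0 sub0r; congr EFin.
  by field; rewrite !gt_eqF.
- move=> x; rewrite mulr_ge0 ?expR_ge0// -lerBlDl sub0r; exact: cos_geN1.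
- apply: (@is_derive1_continuous _ (fun x =>
    - e * expR (- e * x) * (1 + cos (a * x)) - a * (expR (- e * x) * sin (a * x)))).
  move=> x; apply: is_derive_eq; rewrite /GRing.scale /=; ring.
- rewrite -[X in _ --> X](addr0 (0 : R)); apply: cvgD.
    rewrite -(mulr0 (- e^-1)); apply: cvgMl_tmp; exact: expRNM_cvgy.
  by rewrite -(mulr0 (e ^+ 2 + a ^+ 2)^-1); apply: cvgMl_tmp.
Unshelve. all: by end_near. Qed.

Let ge0y : [set x : R | 0 <= x] = `[0, +oo[%classic.
Proof. by rewrite set_itvcy. Qed.

Lemma integral_laplace_1Dcos e a : 0 < e ->
  (\int[mu1]_x (laplace e x * (1 + cos (a * x)))%:E =
   (2 / e + cauchy e a)%:E)%E.
Proof.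
move=> e0; rewrite ge0_symfun_integralT.
- rewrite ge0y (_ : (2 / e + _) = 2 * (e^-1 + e / (e ^+ 2 + a ^+ 2))); last first.
    by rewrite /cauchy mulrDr mulrA.
  rewrite EFinM -(ftc_laplace a e0); congr (_ * _)%E; apply: eq_integral => x.
  by rewrite inE/= in_itv/= andbT => x0; rewrite /laplace ger0_norm.
- by move=> x; rewrite mulr_ge0 ?expR_ge0// -lerBlDl sub0r cos_geN1.
- move=> x; apply: (@continuousM _ R^o); first exact: continuous_laplace.
  apply: (@continuousD _ R^o); first exact: cst_continuous.
  apply: continuous_comp; last exact: continuous_cos.
  by apply: mulrl_continuous.
- by move=> x; rewrite /laplace/= normrN mulrN cosN.
Qed.

Lemma integral_laplace e : 0 < e -> (\int[mu1]_x (laplace e x)%:E = (2 / e)%:E)%E.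
Proof.
(* At a = 0 the factor 1 + cos is the constant 2, so twice the mass is known. *)
move=> e0; have := integral_laplace_1Dcos 0 e0.
under eq_integral do rewrite mul0r cos0 mulrC EFinM.
rewrite ge0_integralZl//; last 2 first.
- apply/measurable_EFinP; apply: continuous_measurable_fun.
  exact: continuous_laplace.
- by move=> x _; rewrite lee_fin laplace_ge0.
rewrite (_ : 2 / e + cauchy e 0 = (1 + 1) * (2 / e)); last first.
  by rewrite /cauchy; field; rewrite !gt_eqF// sqr_add_gt0.
move=> /(congr1 (fun z => ((1 + 1)^-1)%:E * z)%E).
have n0 : 1 + 1 != 0 :> R by rewrite gt_eqF.
by rewrite !EFinM !muleA -!EFinM mulVf// mul1e mul1r.
Qed.

Lemma integrable_laplace e : 0 < e -> mu1.-integrable setT (fun x => (laplace e x)%:E).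
Proof.
move=> e0; apply/integrableP; split.
  apply/measurable_EFinP; apply: continuous_measurable_fun.
  exact: continuous_laplace.
under eq_integral do rewrite gee0_abs ?lee_fin ?laplace_ge0//.
by rewrite integral_laplace// ltry.
Qed.

Lemma integrable_laplaceM e (h : R -> R) : 0 < e -> continuous h ->
  (forall x, `|h x| <= 1) ->
  mu1.-integrable setT (fun x => (laplace e x * h x)%:E).
Proof.
move=> e0 ch h1; apply: le_integrable (integrable_laplace e0) => //.
  apply/measurable_EFinP; apply: measurable_funM;
    apply: continuous_measurable_fun => //; exact: continuous_laplace.
move=> x _ /=; rewrite lee_fin normrM ler_piMr//.
Qed.

Lemma integral_laplace_cos e a : 0 < e ->
  (\int[mu1]_x (laplace e x * cos (a * x))%:E = (cauchy e a)%:E)%E.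
Proof.
move=> e0.
have := integral_laplace_1Dcos a e0.
under eq_integral do rewrite mulrDr mulr1 EFinD.
rewrite integralD//; last 2 first.
- exact: integrable_laplace.
- apply: integrable_laplaceM => //.
    move=> x; apply: continuous_comp; last exact: continuous_cos.
    exact: mulrl_continuous.
  by move=> x; rewrite ler_norml cos_geN1 cos_le1.
rewrite integral_laplace// EFinD.
by move=> /(congr1 (fun z => z - (2 / e)%:E)%E); rewrite addeAC subee// add0e addeAC subee// add0e.
Qed.

(** The integrand is odd: reflection exchanges its positive and negative parts, whose finite
    integrals cancel. *)
Lemma integral_laplace_sin e a : 0 < e ->
  (\int[mu1]_x (laplace e x * sin (a * x))%:E = 0)%E.
Proof.
move=> e0; set f := fun x => _.
have fi : mu1.-integrable setT f.
  apply: integrable_laplaceM => //.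
    move=> x; apply: continuous_comp; last exact: continuous_sin.
    exact: mulrl_continuous.
  by move=> x; rewrite ler_norml sin_geN1 sin_le1.
have mf : measurable_fun setT f by exact: measurable_int fi.
have fN x : (f^\- x = f^\+ (-1 * x + 0)%R)%E.
  by rewrite funeposE funenegE /f mulN1r addr0 /laplace normrN mulrN sinN mulrN.
rewrite integralE; under [X in (_ - X)%E]eq_integral do rewrite fN.
rewrite (@ge0_integral_affine1 _ (-1) 0 f^\+%E)//; last first.
  exact: measurable_funepos.
rewrite normrN1 invr1 mul1e subee//; exact: integrable_pos_fin_num.
Qed.

Lemma integral_oneDsqrV : (\int[mu1]_x ((oneDsqr x)^-1)%:E = pi%:E)%E.
Proof.
rewrite ge0_symfun_integralT.
- rewrite ge0y integral0y_oneDsqr -EFinM; congr EFin.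
  by rewrite mulrC divfK.
- by move=> x; rewrite invr_ge0.
- exact: continuous_oneDsqrV.
- by move=> x; rewrite /= /oneDsqr sqrrN.
Qed.

(** With x = 2 pi (t - s) / e the integrand becomes (2 / e) / (1 + x^2), and (2 / e) (e / (2 pi)) pi
    = 1. The factor 2 pi of the Fourier phase is thus what gives the kernel mass one. *)
Lemma integral_cauchy e s : 0 < e ->
  (\int[mu1]_t (cauchy e (2 * pi * (t - s)))%:E = 1)%E.
Proof.
move=> e0; have p0 := pi_gt0 R.
have a0 : 0 < 2 * pi / e by rewrite divr_gt0// mulr_gt0.
pose g x : \bar R := (2 / e * (oneDsqr x)^-1)%:E.
have mV : measurable_fun setT (fun x : R => ((oneDsqr x)^-1)%:E).
  apply/measurable_EFinP; apply: continuous_measurable_fun.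
  exact: continuous_oneDsqrV.
transitivity (\int[mu1]_t g (2 * pi / e * t + - (2 * pi / e * s))%R)%E.
  apply: eq_integral => t _; rewrite /g -mulrBr; congr EFin.
  set y := 2 * pi * (t - s); have d0 := sqr_add_gt0 y e0.
  rewrite (_ : 2 * pi / e * (t - s) = y / e); last by rewrite /y mulrAC.
  rewrite /cauchy /oneDsqr; field; by rewrite ?gt_eqF.
rewrite ge0_integral_affine1.
- rewrite /g; under eq_integral do rewrite EFinM.
  rewrite ge0_integralZl_EFin; [|by []| |exact: mV|by rewrite divr_ge0// ltW]; last first.
    by move=> x _; rewrite lee_fin invr_ge0.
  rewrite integral_oneDsqrV -!EFinM gtr0_norm//; congr EFin.
  by clear -p0 e0; move: (pi) p0 => P p0; field; rewrite !gt_eqF.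
- by rewrite gt_eqF.
- apply/measurable_EFinP; apply: measurable_funM => //.
  exact/measurable_EFinP.
- by move=> x; rewrite lee_fin mulr_ge0 ?invr_ge0// divr_ge0// ltW.
Qed.

End laplace_kernel_1d.

Section integral_lemmas.
Context d (T : measurableType d) (R : realType).
Variable mu : {measure set T -> \bar R}.

Lemma integral_linear_comb (f g : T -> R) (A B al be : R) :
  mu.-integrable setT (fun x => (f x)%:E) ->
  mu.-integrable setT (fun x => (g x)%:E) ->
  (\int[mu]_x (f x)%:E = A%:E)%E -> (\int[mu]_x (g x)%:E = B%:E)%E ->
  (\int[mu]_x (al * f x + be * g x)%:E = (al * A + be * B)%:E)%E.
Proof.
move=> fi gi fA gB; under eq_integral do rewrite EFinD !EFinM.
rewrite integralD; [|by []|exact: integrableZl|exact: integrableZl].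
by rewrite !integralZl// fA gB.
Qed.

Lemma integrable_EFinD (f g : T -> R) :
  mu.-integrable setT (fun x => (f x)%:E) ->
  mu.-integrable setT (fun x => (g x)%:E) ->
  mu.-integrable setT (fun x => (f x + g x)%:E).
Proof. by move=> fi gi; exact: (integrableD measurableT fi gi). Qed.

Lemma integrable_EFinB (f g : T -> R) :
  mu.-integrable setT (fun x => (f x)%:E) ->
  mu.-integrable setT (fun x => (g x)%:E) ->
  mu.-integrable setT (fun x => (f x - g x)%:E).
Proof. by move=> fi gi; exact: (integrableB measurableT fi gi). Qed.

Lemma integrable_bounded_mul (f h : T -> R) (k : R) :
  mu.-integrable setT (fun x => (f x)%:E) -> measurable_fun setT h ->
  (forall x, `|h x| <= k) -> mu.-integrable setT (fun x => (f x * h x)%:E).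
Proof.
move=> fi mh hk.
have mf : measurable_fun setT f by apply/measurable_EFinP; exact: measurable_int fi.
apply: (le_integrable measurableT _ _ (integrableZr measurableT k fi)).
  by apply/measurable_EFinP; exact: measurable_funM.
move=> x _ /=; rewrite lee_fin !normrM ler_wpM2l// (le_trans (hk x))//.
exact: ler_norm.
Qed.

End integral_lemmas.

(* The library's sigma-finite instance on [m1 \x m2] is shadowed by a later one
   that requires subprobabilities, hence this renamed copy. *)
Section sigma_finite_product.
Context d1 d2 (T1 : measurableType d1) (T2 : measurableType d2) (R : realType).
Variable m1 : {sigma_finite_measure set T1 -> \bar R}.
Variable m2 : {sigma_finite_measure set T2 -> \bar R}.

Definition product_sf : set (T1 * T2) -> \bar R := (m1 \x m2)%E.

HB.instance Definition _ := Measure.on product_sf.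

HB.instance Definition _ := @Measure_isSigmaFinite.Build _ _ _ product_sf
  (product_sigma_finite m1 m2).

Lemma product_sf_tonelli1 (f : T1 * T2 -> \bar R) : measurable_fun setT f ->
  (forall p, 0 <= f p)%E ->
  (\int[product_sf]_p f p = \int[m1]_x \int[m2]_y f (x, y))%E.
Proof. exact: fubini_tonelli1. Qed.

Lemma product_sf_tonelli2 (f : T1 * T2 -> \bar R) : measurable_fun setT f ->
  (forall p, 0 <= f p)%E ->
  (\int[product_sf]_p f p = \int[m2]_y \int[m1]_x f (x, y))%E.
Proof. exact: fubini_tonelli2. Qed.

End sigma_finite_product.

Section product_integral.
Context d1 d2 (T1 : measurableType d1) (T2 : measurableType d2) (R : realType).
Variable m1 : {sigma_finite_measure set T1 -> \bar R}.
Variable m2 : {sigma_finite_measure set T2 -> \bar R}.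

Lemma integrable_tensor (f : T1 -> R) (g : T2 -> R) :
  m1.-integrable setT (fun x => (f x)%:E) ->
  m2.-integrable setT (fun x => (g x)%:E) ->
  (product_sf m1 m2).-integrable setT (fun p => (f p.1 * g p.2)%:E).
Proof.
move=> fi gi.
have mf : measurable_fun setT f by apply/measurable_EFinP; exact: measurable_int fi.
have mg : measurable_fun setT g by apply/measurable_EFinP; exact: measurable_int gi.
apply/(@integrable12ltyP _ _ _ _ _ m1 m2).
  apply/measurable_EFinP; apply: measurable_funM.
    exact: (measurableT_comp mf).
  exact: (measurableT_comp mg).
under eq_integral => x _.
  under eq_integral do rewrite /= normrM EFinM.
  rewrite ge0_integralZl_EFin//; last first.
    exact/measurable_EFinP/measurableT_comp.
  over.
have gfin : (\int[m2]_y `|(g y)%:E| \is a fin_num)%E.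
  by apply: integrable_fin_num => //; exact: (integrable_abse gi).
rewrite ge0_integralZr//; last 2 first.
- exact/measurable_EFinP/measurableT_comp.
- by apply: integral_ge0.
rewrite lte_mul_pinfty//.
- exact: integral_ge0.
- by apply: integrable_fin_num => //; exact: (integrable_abse fi).
- by rewrite ltey_eq gfin.
Qed.

Lemma integral_tensor (f : T1 -> R) (g : T2 -> R) :
  m1.-integrable setT (fun x => (f x)%:E) ->
  m2.-integrable setT (fun x => (g x)%:E) ->
  (\int[product_sf m1 m2]_p (f p.1 * g p.2)%:E =
   (\int[m1]_x f x * \int[m2]_x g x)%R%:E)%E.
Proof.
move=> fi gi.
apply: etrans (esym (integral12_prod_meas1 (integrable_tensor fi gi))) _.
rewrite /fubini_F/=.
under eq_integral => x _.
  under eq_integral do rewrite EFinM.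
  rewrite integralZl// -[X in (_ * X)%E]fineK ?integrable_fin_num// -EFinM mulrC EFinM.
  over.
by rewrite integralZl// -[X in (_ * X)%E]fineK ?integrable_fin_num// -EFinM mulrC.
Qed.

(** Tonelli gives measurability for the positive and negative parts separately, and [fine] is
    measurable, so sections with an infinite integral do no harm. *)
Lemma measurable_Rintegral_param (k : T1 * T2 -> R) : measurable_fun setT k ->
  measurable_fun setT (fun x => \int[m2]_y k (x, y)).
Proof.
move=> mk; apply: (@measurableT_comp _ _ _ _ _ _ fine); first exact: fine_measurable.
have -> : (fun x => \int[m2]_y (k (x, y))%:E)%E =
  (fun x => \int[m2]_y ((EFin \o k)^\+ (x, y)) - \int[m2]_y ((EFin \o k)^\- (x, y)))%E.
  apply/funext => x; rewrite integralE.
  by congr (_ - _)%E; apply: eq_integral => y _; rewrite !(funeposE, funenegE).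
have mk' : measurable_fun setT (EFin \o k) by exact/measurable_EFinP.
apply: emeasurable_funB.
  apply: (measurable_fun_fubini_tonelli_F (EFin \o k)^\+%E) => //.
  exact: measurable_funepos.
apply: (measurable_fun_fubini_tonelli_F (EFin \o k)^\-%E) => //.
exact: measurable_funeneg.
Qed.

End product_integral.

(** * Tensor products of the Laplace weight and their Fourier transforms *)

Section laplace_kernel_cV.
Context {R : realType}.
Local Notation leb n := (lebesgue_cV (R := R) n).
Local Notation mu1 := (@lebesgue_measure R).

Lemma integrable_cV_succ n (f : 'cV[R]_n.+1 -> \bar R) :
  (leb n.+1).-integrable setT f ->
  (mu1 \x leb n)%E.-integrable setT (fun p => f (cV_cons p)).
Proof.
move=> /integrableP[mf fi]; apply/integrableP; split.
  by apply: measurableT_comp => //; exact: measurable_cV_cons.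
rewrite -(@integral_cV_succ _ _ (fun v => `|f v|)%E)//.
exact: measurableT_comp.
Qed.

Lemma fubini_cV_succ n (f : 'cV[R]_n.+1 -> \bar R) :
  (leb n.+1).-integrable setT f ->
  (\int[leb n.+1]_v f v = \int[mu1]_t \int[leb n]_v f (cV_cons (t, v)))%E.
Proof.
move=> fi; have fi' := integrable_cV_succ fi.
rewrite (integral12_prod_meas1 fi').
have mf : measurable_fun setT f by exact: measurable_int fi.
rewrite integralE [in RHS]integralE.
rewrite (integral_cV_succ (measurable_funepos mf) (funepos_ge0 f)).
rewrite (integral_cV_succ (measurable_funeneg mf) (funeneg_ge0 f)).
by congr (_ - _)%E; apply: eq_integral => p _; rewrite !(funeposE, funenegE).
Qed.

Definition laplacen n e (x : 'cV[R]_n) := \prod_i laplace e (x i 0).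

Definition cauchyn n e (x : 'cV[R]_n) := \prod_i cauchy e (x i 0).

Lemma laplacen_ge0 n e (x : 'cV[R]_n) : 0 <= laplacen e x.
Proof. by apply: prodr_ge0 => i _; exact: laplace_ge0. Qed.

Lemma cauchy_ge0 (e a : R) : 0 < e -> 0 <= cauchy e a.
Proof.
by move=> e0; rewrite /cauchy divr_ge0 ?mulr_ge0 ?addr_ge0 ?sqr_ge0// ltW.
Qed.

Lemma cauchyn_ge0 n e (x : 'cV[R]_n) : 0 < e -> 0 <= cauchyn e x.
Proof. by move=> e0; apply: prodr_ge0 => i _; exact: cauchy_ge0. Qed.

Lemma measurable_laplacen n e : measurable_fun setT (@laplacen n e).
Proof.
apply: measurable_prod => i _.
apply: (@measurableT_comp _ _ _ _ _ _ (laplace e)).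
  by apply: continuous_measurable_fun; exact: continuous_laplace.
exact: measurable_cV_entry.
Qed.

Lemma measurable_cauchyn d (T : measurableType d) n e (f : T -> 'cV[R]_n) :
  0 < e -> measurable_fun setT f -> measurable_fun setT (fun t => cauchyn e (f t)).
Proof.
move=> e0 mf; apply: measurable_prod => i _.
apply: (@measurableT_comp _ _ _ _ _ _ (cauchy e)); last exact: measurable_cV_entry.
apply: continuous_measurable_fun => x.
apply: (@continuousM _ R^o (fun=> 2 * e) (fun x => (e ^+ 2 + x ^+ 2)^-1)).
  exact: cst_continuous.
apply: continuousV; first by rewrite gt_eqF// sqr_add_gt0.
apply: (@continuousD _ R^o R^o (fun=> e ^+ 2) (fun x => x ^+ 2)).
  exact: cst_continuous.
exact: exprn_continuous.
Qed.

Lemma laplacen_cons n e t (x : 'cV[R]_n) :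
  laplacen e (cV_cons (t, x)) = laplace e t * laplacen e x.
Proof.
rewrite /laplacen big_ord_recl cV_cons0; congr (_ * _).
by apply: eq_bigr => i _; rewrite cV_consS.
Qed.

Lemma cauchyn_cons n e t (x : 'cV[R]_n) :
  cauchyn e (cV_cons (t, x)) = cauchy e t * cauchyn e x.
Proof.
rewrite /cauchyn big_ord_recl cV_cons0; congr (_ * _).
by apply: eq_bigr => i _; rewrite cV_consS.
Qed.

Lemma dotcV_cons n t s (x y : 'cV[R]_n) :
  dotcV (cV_cons (t, x)) (cV_cons (s, y)) = t * s + dotcV x y.
Proof.
rewrite /dotcV big_ord_recl !cV_cons0; congr (_ + _).
by apply: eq_bigr => i _; rewrite !cV_consS.
Qed.

Lemma integral_laplacen n e : 0 < e ->
  (\int[leb n]_x (laplacen e x)%:E = ((2 / e) ^+ n)%:E)%E.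
Proof.
move=> e0; elim: n => [|n IH].
  rewrite ge0_integral_cV0 /laplacen ?big_ord0 ?expr0//.
    by apply/measurable_EFinP; exact: measurable_laplacen.
  by move=> v; rewrite lee_fin big_ord0.
rewrite tonelli_cV_succ; last 2 first.
- by apply/measurable_EFinP; exact: measurable_laplacen.
- by move=> v; rewrite lee_fin laplacen_ge0.
under eq_integral => t _.
  under eq_integral => x _ do rewrite laplacen_cons EFinM.
  rewrite ge0_integralZl_EFin; last 4 first.
  - by [].
  - by move=> x _; rewrite lee_fin laplacen_ge0.
  - by apply/measurable_EFinP; exact: measurable_laplacen.
  - exact: laplace_ge0.
  rewrite IH; over.
rewrite ge0_integralZr; last 4 first.
- by [].
- apply/measurable_EFinP; apply: continuous_measurable_fun.
  exact: continuous_laplace.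
- by move=> x _; rewrite lee_fin laplace_ge0.
- by rewrite lee_fin exprn_ge0// divr_ge0// ltW.
by rewrite integral_laplace// -EFinM exprS.
Qed.

Lemma integrable_laplacen n e : 0 < e ->
  (leb n).-integrable setT (fun x => (laplacen e x)%:E).
Proof.
move=> e0; apply/integrableP; split.
  by apply/measurable_EFinP; exact: measurable_laplacen.
under eq_integral do rewrite gee0_abs ?lee_fin ?laplacen_ge0//.
by rewrite integral_laplacen// ltry.
Qed.

Lemma measurable_cos : measurable_fun setT (@cos R).
Proof. by apply: continuous_measurable_fun; exact: continuous_cos. Qed.

Lemma measurable_sin : measurable_fun setT (@sin R).
Proof. by apply: continuous_measurable_fun; exact: continuous_sin. Qed.

Lemma normr_cos_le1 (x : R) : `|cos x| <= 1.
Proof. by rewrite ler_norml cos_geN1 cos_le1. Qed.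

Lemma normr_sin_le1 (x : R) : `|sin x| <= 1.
Proof. by rewrite ler_norml sin_geN1 sin_le1. Qed.

Lemma integrable_laplacen_cos n e (a : 'cV[R]_n) : 0 < e ->
  (leb n).-integrable setT (fun x => (laplacen e x * cos (dotcV x a))%:E).
Proof.
move=> e0; apply: (integrable_bounded_mul (k := 1) (integrable_laplacen n e0)).
  by apply: (measurableT_comp measurable_cos); exact: measurable_dotcV.
by move=> x; exact: normr_cos_le1.
Qed.

Lemma integrable_laplacen_sin n e (a : 'cV[R]_n) : 0 < e ->
  (leb n).-integrable setT (fun x => (laplacen e x * sin (dotcV x a))%:E).
Proof.
move=> e0; apply: (integrable_bounded_mul (k := 1) (integrable_laplacen n e0)).
  by apply: (measurableT_comp measurable_sin); exact: measurable_dotcV.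
by move=> x; exact: normr_sin_le1.
Qed.

(** The cosine and sine integrals are treated together because the addition formulas mix them when a
    coordinate is split off. The terms with a sine in the remaining coordinates vanish by the
    induction hypothesis. *)
Lemma fourier_laplacen n e (a : 'cV[R]_n) : 0 < e ->
  (\int[leb n]_x (laplacen e x * cos (dotcV x a))%:E = (cauchyn e a)%:E)%E /\
  (\int[leb n]_x (laplacen e x * sin (dotcV x a))%:E = 0)%E.
Proof.
move=> e0; elim: n a => [|n IH] a.
  split.
    under eq_integral do rewrite /laplacen /dotcV !big_ord0 cos0 mulr1.
    by rewrite ge0_integral_cV0// /cauchyn big_ord0.
  under eq_integral do rewrite /dotcV !big_ord0 sin0 mulr0.
  by rewrite integral0.
have ci t : mu1.-integrable setT (fun x => (laplace e x * cos (t * x))%:E).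
  apply: integrable_laplaceM => //; last by move=> x; exact: normr_cos_le1.
  move=> x; apply: continuous_comp; last exact: continuous_cos.
  exact: mulrl_continuous.
have si t : mu1.-integrable setT (fun x => (laplace e x * sin (t * x))%:E).
  apply: integrable_laplaceM => //; last by move=> x; exact: normr_sin_le1.
  move=> x; apply: continuous_comp; last exact: continuous_sin.
  exact: mulrl_continuous.
rewrite (cV_consE a); set a0 := a 0 0; set b := \col_i _; clearbody a0 b.
have [IHc IHs] := IH b.
split.
  rewrite fubini_cV_succ; last exact: integrable_laplacen_cos.
  under eq_integral => t _.
    under eq_integral => x _.
      rewrite laplacen_cons dotcV_cons cosD mulrBr !mulrA.
      rewrite (_ : _ - _ = (laplace e t * cos (a0 * t)) * (laplacen e x * cos (dotcV x b)) +
       (- (laplace e t * sin (a0 * t))) * (laplacen e x * sin (dotcV x b))); last first.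
        by rewrite (mulrC a0); ring.
      over.
    rewrite (integral_linear_comb _ _ (integrable_laplacen_cos b e0)
      (integrable_laplacen_sin b e0) IHc IHs) mulr0 addr0 mulrC EFinM; over.
  rewrite integralZl// integral_laplace_cos// -EFinM cauchyn_cons; congr EFin.
  by rewrite mulrC.
rewrite fubini_cV_succ; last exact: integrable_laplacen_sin.
under eq_integral => t _.
  under eq_integral => x _.
    rewrite laplacen_cons dotcV_cons sinD.
    rewrite (_ : _ * (_ + _) = (laplace e t * sin (a0 * t)) * (laplacen e x * cos (dotcV x b)) +
      (laplace e t * cos (a0 * t)) * (laplacen e x * sin (dotcV x b))); last first.
      by rewrite (mulrC a0); ring.
    over.
  rewrite (integral_linear_comb _ _ (integrable_laplacen_cos b e0)
    (integrable_laplacen_sin b e0) IHc IHs) mulr0 addr0 mulrC EFinM; over.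
by rewrite integralZl// integral_laplace_sin// mule0.
Qed.

Lemma integral_cauchyn n e (s : 'cV[R]_n) : 0 < e ->
  (\int[leb n]_t (cauchyn e ((2 * pi) *: (t - s)))%:E = 1)%E.
Proof.
move=> e0; elim: n s => [|n IH] s.
  under eq_integral do rewrite /cauchyn big_ord0.
  by rewrite ge0_integral_cV0.
have mC m (c : 'cV[R]_m) : measurable_fun setT
    (fun t : 'cV[R]_m => (cauchyn e ((2 * pi) *: (t - c)))%:E).
  apply/measurable_EFinP; apply: measurable_cauchyn => //.
  rewrite (_ : (fun t => _) = fun t => ((2 * pi)%:M *m t + (2 * pi)%:M *m - c)).
    exact: measurable_cV_affine.
  by apply/funext => t; rewrite -mulmxDr mul_scalar_mx.
rewrite tonelli_cV_succ; [|exact: mC|]; last first.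
  by move=> v; rewrite lee_fin cauchyn_ge0.
pose s' := \col_i s (lift ord0 i) 0.
have cE t x : (2 * pi) *: (cV_cons (t, x) - s) =
    cV_cons (2 * pi * (t - s 0 0), (2 * pi) *: (x - s')).
  have c0 := cV_cons0 (t, x); have cS := cV_consS (t, x); move: c0 cS.
  move: (cV_cons (t, x)) => c /= c0 cS.
  apply/colP => i; case: (unliftP ord0 i) => [j ->|->].
    by rewrite cV_consS !mxE cS.
  by rewrite cV_cons0 !mxE c0.
under eq_integral => t _.
  under eq_integral => x _ do rewrite cE cauchyn_cons EFinM.
  rewrite ge0_integralZl_EFin; last 4 first.
  - by [].
  - by move=> x _; rewrite lee_fin cauchyn_ge0.
  - exact: mC.
  - exact: cauchy_ge0.
  rewrite IH mule1; over.
exact: integral_cauchy.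
Qed.

End laplace_kernel_cV.

Lemma dotcVBr (R : realType) n (x y z : 'cV[R]_n) :
  dotcV x (y - z) = dotcV x y - dotcV x z.
Proof.
rewrite /dotcV -sumrB; apply: eq_bigr => i _.
by rewrite !mxE mulrBr.
Qed.

Lemma dotcVZr (R : realType) n k (x y : 'cV[R]_n) :
  dotcV x (k *: y) = k * dotcV x y.
Proof. by rewrite /dotcV mulr_sumr; apply: eq_bigr => i _; rewrite mxE mulrCA. Qed.

(** * The inequality for a + i b with a and b integrable *)

Section plancherel.
Context {R : realType} (n : nat).
Local Notation leb := (lebesgue_cV (R := R) n).
Variables a b : 'cV[R]_n -> R.
Hypothesis ai : leb.-integrable setT (fun y => (a y)%:E).
Hypothesis bi : leb.-integrable setT (fun y => (b y)%:E).

(* [u x] and [w x] are the real and imaginary parts of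
   [(a + i b) exp (- i th x)]. *)
Let th (x y : 'cV[R]_n) := 2 * pi * dotcV x y.
Let u x y := a y * cos (th x y) + b y * sin (th x y).
Let w x y := b y * cos (th x y) - a y * sin (th x y).
Let S x := (\int[leb]_y u x y) ^+ 2 + (\int[leb]_y w x y) ^+ 2.
Let M := (\int[leb]_y (a y ^+ 2 + b y ^+ 2)%:E)%E.
Let h y : R := `|a y| + `|b y|.

Let ma : measurable_fun setT a.
Proof. by apply/measurable_EFinP; exact: measurable_int ai. Qed.

Let mb : measurable_fun setT b.
Proof. by apply/measurable_EFinP; exact: measurable_int bi. Qed.

Let mth d (T : measurableType d) (f g : T -> 'cV[R]_n) :
  measurable_fun setT f -> measurable_fun setT g ->
  measurable_fun setT (fun t => th (f t) (g t)).
Proof. by move=> mf mg; apply: measurable_funM => //; exact: measurable_dotcV. Qed.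

Let meas_u d (T : measurableType d) (f g : T -> 'cV[R]_n) :
  measurable_fun setT f -> measurable_fun setT g ->
  measurable_fun setT (fun t => u (f t) (g t)).
Proof.
move=> mf mg; apply: measurable_funD; apply: measurable_funM.
- exact: (measurableT_comp ma).
- by apply: (measurableT_comp measurable_cos); exact: mth.
- exact: (measurableT_comp mb).
- by apply: (measurableT_comp measurable_sin); exact: mth.
Qed.

Let meas_w d (T : measurableType d) (f g : T -> 'cV[R]_n) :
  measurable_fun setT f -> measurable_fun setT g ->
  measurable_fun setT (fun t => w (f t) (g t)).
Proof.
move=> mf mg; apply: measurable_funB; apply: measurable_funM.
- exact: (measurableT_comp mb).
- by apply: (measurableT_comp measurable_cos); exact: mth.
- exact: (measurableT_comp ma).
- by apply: (measurableT_comp measurable_sin); exact: mth.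
Qed.

Let ui x : leb.-integrable setT (fun y => (u x y)%:E).
Proof.
apply: integrable_EFinD.
- apply: (integrable_bounded_mul (k := 1)) => //.
    by apply: (measurableT_comp measurable_cos); exact: mth.
  by move=> y; exact: normr_cos_le1.
- apply: (integrable_bounded_mul (k := 1)) => //.
    by apply: (measurableT_comp measurable_sin); exact: mth.
  by move=> y; exact: normr_sin_le1.
Qed.

Let wi x : leb.-integrable setT (fun y => (w x y)%:E).
Proof.
apply: integrable_EFinB.
- apply: (integrable_bounded_mul (k := 1)) => //.
    by apply: (measurableT_comp measurable_cos); exact: mth.
  by move=> y; exact: normr_cos_le1.
- apply: (integrable_bounded_mul (k := 1)) => //.
    by apply: (measurableT_comp measurable_sin); exact: mth.
  by move=> y; exact: normr_sin_le1.
Qed.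

Let hi : leb.-integrable setT (fun y => (h y)%:E).
Proof. by apply: integrable_EFinD; exact: integrable_norm. Qed.

Let S_ge0 x : 0 <= S x. Proof. by rewrite addr_ge0 ?sqr_ge0. Qed.

Let mS : measurable_fun setT S.
Proof.
apply: measurable_funD; apply: measurable_funX.
- apply: (measurable_Rintegral_param leb (k := fun p => u p.1 p.2)).
  exact: meas_u.
- apply: (measurable_Rintegral_param leb (k := fun p => w p.1 p.2)).
  exact: meas_w.
Qed.

Let mab : measurable_fun setT (fun y => (a y ^+ 2 + b y ^+ 2)%:E).
Proof. by apply/measurable_EFinP; apply: measurable_funD; exact: measurable_funX. Qed.

(** With F = a + i b, [A] and [B] are the real and imaginary parts of F(p.1) conj(F(p.2)). *)
Let A (p : 'cV[R]_n * 'cV[R]_n) := a p.1 * a p.2 + b p.1 * b p.2.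
Let B (p : 'cV[R]_n * 'cV[R]_n) := b p.1 * a p.2 - a p.1 * b p.2.

(** A square of an integral is a double integral. Written this way, the squared modulus of the
    Fourier transform can be integrated in x before p. *)
Let SE x : ((S x)%:E = \int[product_sf leb leb]_p (u x p.1 * u x p.2 + w x p.1 * w x p.2)%:E)%E.
Proof.
have uu := integrable_tensor (ui x) (ui x); have ww := integrable_tensor (wi x) (wi x).
under eq_integral do rewrite EFinD.
by rewrite integralD// !integral_tensor// -EFinD !expr2.
Qed.

(** Both sides are the real part of F(p.1) conj(F(p.2)) exp(-i (th x p.1 - th x p.2)). The variable
    x now enters through a single phase, to which the transform of [laplacen e] applies. *)
Let uwE x p : u x p.1 * u x p.2 + w x p.1 * w x p.2 =
  A p * cos (dotcV x ((2 * pi) *: (p.1 - p.2))) +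
  B p * sin (dotcV x ((2 * pi) *: (p.1 - p.2))).
Proof.
rewrite dotcVZr dotcVBr (mulrBr (2 * pi)) cosB sinB -/(th x p.1) -/(th x p.2) /u /w /A /B.
ring.
Qed.

Section regularization.
Variable e : R.
Hypothesis e0 : 0 < e.

Let k x (p : 'cV[R]_n * 'cV[R]_n) :=
  laplacen e x * (u x p.1 * u x p.2 + w x p.1 * w x p.2).

Let k_bound x p : `|k x p| <= laplacen e x * (2 * (h p.1 * h p.2)).
Proof.
rewrite normrM ger0_norm ?laplacen_ge0// ler_wpM2l ?laplacen_ge0//.
have uh y : `|u x y| <= h y.
  rewrite (le_trans (ler_normD _ _))// !normrM lerD//.
    by apply: ler_piMr; rewrite ?normr_ge0 ?normr_cos_le1.
  by apply: ler_piMr; rewrite ?normr_ge0 ?normr_sin_le1.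
have wh y : `|w x y| <= h y.
  rewrite (le_trans (ler_normB _ _))// !normrM addrC lerD//.
    by apply: ler_piMr; rewrite ?normr_ge0 ?normr_sin_le1.
  by apply: ler_piMr; rewrite ?normr_ge0 ?normr_cos_le1.
rewrite (le_trans (ler_normD _ _))// mulr_natl mulr2n !normrM.
by rewrite lerD// ler_pM.
Qed.

(** The bound by h(p.1) h(p.2) is independent of x, so integrability in x comes entirely from the
    weight; this is what permits exchanging the order of integration. *)
Let ki : (leb \x product_sf leb leb)%E.-integrable setT (fun q => (k q.1 q.2)%:E).
Proof.
have li := integrable_laplacen n e0.
have hhi := integrable_tensor hi hi.
have hh2 : (product_sf leb leb).-integrable setT (fun p => (2 * (h p.1 * h p.2))%:E).
  exact: (integrableZl measurableT 2 hhi).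
have I := integrable_tensor li hh2.
apply: (le_integrable measurableT _ _ I).
  apply/measurable_EFinP; apply: measurable_funM.
    exact: (measurableT_comp (@measurable_laplacen _ n e)).
  apply: measurable_funD; apply: measurable_funM.
  - by apply: meas_u => //; apply: measurableT_comp.
  - by apply: meas_u => //; apply: measurableT_comp.
  - by apply: meas_w => //; apply: measurableT_comp.
  - by apply: meas_w => //; apply: measurableT_comp.
move=> [x p] _; rewrite lee_fin/= (le_trans (k_bound _ _))//.
exact: ler_norm.
Qed.

Let int_kx p : (\int[leb]_x (k x p)%:E =
  (A p * cauchyn e ((2 * pi) *: (p.1 - p.2)))%:E)%E.
Proof.
set v := (2 * pi) *: _; have [Fc Fs] := fourier_laplacen v e0.
under eq_integral => x _.
  rewrite /k uwE -/v mulrDr !(mulrCA (laplacen e x)); over.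
rewrite (integral_linear_comb _ _ (integrable_laplacen_cos v e0)
  (integrable_laplacen_sin v e0) Fc Fs).
by rewrite mulr0 addr0.
Qed.

Let mker : measurable_fun setT (fun p : 'cV[R]_n * 'cV[R]_n =>
   (cauchyn e ((2 * pi) *: (p.1 - p.2)))).
Proof.
apply: measurable_cauchyn => //.
rewrite (_ : (fun t => _) = fun t : 'cV[R]_n * 'cV[R]_n =>
    ((2 * pi)%:M *m t.1 + (- (2 * pi))%:M *m t.2)).
  by apply: measurable_cV_add; exact: measurable_cV_mul.
by apply/funext => t; rewrite !mul_scalar_mx scaleNr scalerBr.
Qed.

Let integral_kernel1 : (\int[product_sf leb leb]_p
  ((a p.1 ^+ 2 + b p.1 ^+ 2) * cauchyn e ((2 * pi) *: (p.1 - p.2)))%:E = M)%E.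
Proof.
rewrite product_sf_tonelli1; last 2 first.
- apply/measurable_EFinP; apply: measurable_funM; last exact: mker.
  by move/measurable_EFinP : mab => mab'; exact: (measurableT_comp mab').
- by move=> p; rewrite lee_fin mulr_ge0 ?cauchyn_ge0// addr_ge0 ?sqr_ge0.
apply: eq_integral => y _ /=.
(* The kernel is even, so its mass may be computed in either of its two arguments. *)
have cE z : cauchyn e ((2 * pi) *: (y - z)) = cauchyn e ((2 * pi) *: (z - y)).
  apply: eq_bigr => i _; rewrite -opprB scalerN [X in cauchy e X]mxE.
  by rewrite /cauchy sqrrN.
under eq_integral do rewrite EFinM cE.
rewrite ge0_integralZl_EFin; last 4 first.
- by [].
- by move=> x _; rewrite lee_fin cauchyn_ge0.
- apply/measurable_EFinP.
  exact: (measurableT_comp mker (pair2_measurable y)).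
- by rewrite addr_ge0 ?sqr_ge0.
by rewrite integral_cauchyn// mule1.
Qed.

Let integral_kernel2 : (\int[product_sf leb leb]_p
  ((a p.2 ^+ 2 + b p.2 ^+ 2) * cauchyn e ((2 * pi) *: (p.1 - p.2)))%:E = M)%E.
Proof.
rewrite product_sf_tonelli2; last 2 first.
- apply/measurable_EFinP; apply: measurable_funM; last exact: mker.
  by move/measurable_EFinP : mab => mab'; exact: (measurableT_comp mab').
- by move=> p; rewrite lee_fin mulr_ge0 ?cauchyn_ge0// addr_ge0 ?sqr_ge0.
apply: eq_integral => y _ /=.
under eq_integral do rewrite EFinM.
rewrite ge0_integralZl_EFin; last 4 first.
- by [].
- by move=> x _; rewrite lee_fin cauchyn_ge0.
- apply/measurable_EFinP.
  exact: (measurableT_comp mker (pair2_measurable y)).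
- by rewrite addr_ge0 ?sqr_ge0.
by rewrite integral_cauchyn// mule1.
Qed.

(* The weight [laplacen e] makes the Fourier side a double integral against a
   nonnegative kernel [cauchyn e] of mass one, so AM-GM bounds it uniformly in [e]. *)
Lemma plancherel_regularized : (\int[leb]_x (laplacen e x * S x)%:E <= M)%E.
Proof.
have -> : (\int[leb]_x (laplacen e x * S x)%:E =
    \int[leb]_x \int[product_sf leb leb]_p (k x p)%:E)%E.
  apply: eq_integral => x _; rewrite EFinM SE -integralZl//.
  apply: integrable_EFinD; exact: integrable_tensor.
rewrite (Fubini ki).
under eq_integral do rewrite /= int_kx.
pose q y := a y ^+ 2 + b y ^+ 2.
pose c p := cauchyn e ((2 * pi) *: (p.1 - p.2 : 'cV[R]_n)).
have q0 y : 0 <= q y by rewrite addr_ge0 ?sqr_ge0.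
have c0 p : 0 <= c p by exact: cauchyn_ge0.
have mq : measurable_fun setT q by exact/measurable_EFinP.
have mqc1 : measurable_fun setT (fun p => (q p.1 * c p)%:E).
  apply/measurable_EFinP; apply: measurable_funM; last exact: mker.
  exact: (measurableT_comp mq).
have mqc2 : measurable_fun setT (fun p => (q p.2 * c p)%:E).
  apply/measurable_EFinP; apply: measurable_funM; last exact: mker.
  exact: (measurableT_comp mq).
have mAc : measurable_fun setT (fun p => (A p * c p)%:E).
  apply/measurable_EFinP; apply: measurable_funM; last exact: mker.
  apply: measurable_funD; apply: measurable_funM;
    by [exact: (measurableT_comp ma)|exact: (measurableT_comp mb)].
rewrite (le_trans (lee_abs _))// (le_trans (le_abse_integral _ _ mAc))//.
apply: (@le_trans _ _ (\int[product_sf leb leb]_p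
    ((2^-1)%:E * (q p.1 * c p)%:E + (2^-1)%:E * (q p.2 * c p)%:E))%E).
  apply: ge0_le_integral => //.
  - exact: measurableT_comp.
  - by apply: emeasurable_funD; exact: measurable_funeM.
  move=> p _; rewrite lee_fin normrM (ger0_norm (c0 p)) !mulrA -mulrDl ler_wpM2r//.
  rewrite /A /q ler_norml; apply/andP; split.
    have := sqr_ge0 (a p.1 + a p.2); have := sqr_ge0 (b p.1 + b p.2); nra.
  have := sqr_ge0 (a p.1 - a p.2); have := sqr_ge0 (b p.1 - b p.2); nra.
rewrite ge0_integralD//; last 4 first.
- by move=> p _; rewrite mule_ge0// lee_fin mulr_ge0.
- exact: measurable_funeM.
- by move=> p _; rewrite mule_ge0// lee_fin mulr_ge0.
- exact: measurable_funeM.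
rewrite !ge0_integralZl_EFin//; last 2 first.
- by move=> p _; rewrite lee_fin mulr_ge0.
- by move=> p _; rewrite lee_fin mulr_ge0.
rewrite integral_kernel1 integral_kernel2 -ge0_muleDl ?lee_fin ?invr_ge0//.
by rewrite -EFinD (_ : 2^-1 + 2^-1 = 1 :> R) ?mul1e//; field.
Qed.

End regularization.

(** The weights with e = 1 / (k + 1) increase to 1, so monotone convergence removes them while the
    bound, uniform in e, is kept. *)
Lemma plancherel_real : (\int[leb]_x (S x)%:E <= M)%E.
Proof.
have lE (k : nat) (x : 'cV[R]_n) :
    laplacen (k.+1%:R^-1) x = expR (- k.+1%:R^-1 * \sum_i `|x i 0|).
  by rewrite mulr_sumr expR_sum.
pose g k x := (laplacen (k.+1%:R^-1) x * S x)%:E.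
have l1 (x : 'cV[R]_n) : laplacen (k.+1%:R^-1) x @[k --> \oo] --> (1 : R).
  have : expR (- k.+1%:R^-1 * \sum_i `|x i 0|) @[k --> \oo] --> expR (0 : R).
    apply: continuous_cvg; first exact: continuous_expR.
    rewrite -[X in _ --> X](mul0r (\sum_i `|x i 0|)) -oppr0.
    by apply: cvgMr_tmp; apply: cvgN; exact: cvg_harmonic.
  by rewrite expR0; under eq_cvg do rewrite -lE.
have gS x : g k x @[k --> \oo] --> (S x)%:E.
  apply: cvg_EFin; first exact: nearW.
  by rewrite -[X in _ --> X]mul1r; apply: cvgM; [exact: l1|exact: cvg_cst].
have -> : (\int[leb]_x (S x)%:E = \int[leb]_x limn (g ^~ x))%E.
  by apply: eq_integral => x _; apply/esym/cvg_lim => //; exact: gS.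
have g0 k x : (0 <= g k x)%E by rewrite lee_fin mulr_ge0 ?laplacen_ge0.
have mg k : measurable_fun setT (g k).
  apply/measurable_EFinP; apply: measurable_funM => //.
  exact: measurable_laplacen.
have ndg x : {homo g ^~ x : k l / (k <= l)%N >-> (k <= l)%E}.
  move=> k l kl; rewrite lee_fin ler_wpM2r// !lE ler_expR !mulNr lerN2.
  rewrite ler_wpM2r ?sumr_ge0//.
  by rewrite lef_pV2 ?posrE// ler_nat.
rewrite (monotone_convergence _ measurableT mg); last 2 first.
- by move=> k x _; exact: g0.
- by move=> x _; exact: ndg.
apply: lime_le.
  apply: ereal_nondecreasing_is_cvgn => k l kl.
  apply: ge0_le_integral; [by []|by move=> x _; exact: g0|exact: mg|exact: mg|].
  by move=> x _; exact: ndg.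
by apply: nearW => k; apply: plancherel_regularized; rewrite invr_gt0.
Qed.

End plancherel.

(** * Partial Fourier transforms *)

Section complex_numbers.
Context {R : realType}.
Implicit Types z w : R[i].

Lemma ReM z w : complex.Re (z * w) =
  complex.Re z * complex.Re w - complex.Im z * complex.Im w.
Proof. by case: z w => [a b] [c d]. Qed.

Lemma ImM z w : complex.Im (z * w) =
  complex.Re z * complex.Im w + complex.Im z * complex.Re w.
Proof. by case: z w => [a b] [c d]. Qed.

Lemma ReB z w : complex.Re (z - w) = complex.Re z - complex.Re w.
Proof. by case: z w => [a b] [c d]. Qed.

Lemma ImB z w : complex.Im (z - w) = complex.Im z - complex.Im w.
Proof. by case: z w => [a b] [c d]. Qed.

Lemma Re_conj z : complex.Re z^*%C = complex.Re z.
Proof. by case: z. Qed.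

Lemma Im_conj z : complex.Im z^*%C = - complex.Im z.
Proof. by case: z. Qed.

Lemma conjcM z w : (z * w)^*%C = z^*%C * w^*%C.
Proof. exact: rmorphM. Qed.

Lemma complexP z w :
  complex.Re z = complex.Re w -> complex.Im z = complex.Im w -> z = w.
Proof. by case: z w => [a b] [c d] /= -> ->. Qed.

Lemma sqnormc_ge0 z : 0 <= sqnormc z.
Proof. by rewrite addr_ge0 ?sqr_ge0. Qed.

Lemma sqnormcM z w : sqnormc (z * w) = sqnormc z * sqnormc w.
Proof. by rewrite /sqnormc ReM ImM; ring. Qed.

Lemma sqnormc_conj z : sqnormc z^*%C = sqnormc z.
Proof. by rewrite /sqnormc Re_conj Im_conj sqrrN. Qed.

Lemma sqnormc_expi (t : R) : sqnormc (expi t) = 1.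
Proof. exact: cos2Dsin2. Qed.

Lemma sqnormc_real (r : R) : sqnormc r%:C%C = r ^+ 2.
Proof. by rewrite /sqnormc /= expr0n addr0. Qed.

Lemma expiD (s t : R) : expi (s + t) = expi s * expi t.
Proof.
by apply: complexP; rewrite ?ReM ?ImM /= ?cosD ?sinD// addrC.
Qed.

Lemma conj_expi (t : R) : (expi t)^*%C = expi (- t).
Proof. by apply: complexP; rewrite ?Re_conj ?Im_conj /= ?cosN ?sinN. Qed.

Lemma normr_Re_le z : `|complex.Re z| <= Num.sqrt (sqnormc z).
Proof. by rewrite -sqrtr_sqr ler_wsqrtr// lerDl sqr_ge0. Qed.

Lemma normr_Im_le z : `|complex.Im z| <= Num.sqrt (sqnormc z).
Proof. by rewrite -sqrtr_sqr ler_wsqrtr// lerDr sqr_ge0. Qed.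

(** The reverse triangle inequality, squared. It follows from Re(z conj w) <= |z| |w|, which is
    Lagrange's identity with remainder (a d - b c)^2. It is what lets moduli pass to L^2 limits. *)
Lemma sqr_norm_sub_le z w :
  (Num.sqrt (sqnormc z) - Num.sqrt (sqnormc w)) ^+ 2 <= sqnormc (z - w).
Proof.
rewrite sqrrB !sqr_sqrtr ?sqnormc_ge0// -sqrtrM ?sqnormc_ge0//.
case: z w => [a b] [c d].
rewrite /sqnormc /= -subr_ge0.
set s := Num.sqrt _.
have : a * c + b * d <= s.
  rewrite (le_trans (ler_norm _))// -sqrtr_sqr ler_wsqrtr// -subr_ge0.
  rewrite (_ : _ - _ = (a * d - b * c) ^+ 2) ?sqr_ge0//; ring.
rewrite -subr_ge0 => h.
rewrite (_ : _ - _ = 2 * (s - (a * c + b * d))) ?mulr_ge0//; ring.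
Qed.

Section measurability.
Context d (T : measurableType d).
Implicit Types f g : T -> R[i].

Lemma cmeasurableM f g : cmeasurable f -> cmeasurable g ->
  cmeasurable (fun t => f t * g t).
Proof.
move=> [fr fi] [gr gi]; split.
  under eq_fun do rewrite ReM.
  by apply: measurable_funB; exact: measurable_funM.
under eq_fun do rewrite ImM.
by apply: measurable_funD; exact: measurable_funM.
Qed.

Lemma cmeasurableB f g : cmeasurable f -> cmeasurable g ->
  cmeasurable (fun t => f t - g t).
Proof.
move=> [fr fi] [gr gi]; split.
  by under eq_fun do rewrite ReB; exact: measurable_funB.
by under eq_fun do rewrite ImB; exact: measurable_funB.
Qed.

Lemma cmeasurable_conj f : cmeasurable f -> cmeasurable (fun t => (f t)^*%C).
Proof.
move=> [fr fi]; split; first by under eq_fun do rewrite Re_conj.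
by under eq_fun do rewrite Im_conj; exact: measurable_funN.
Qed.

Lemma cmeasurable_expi (f : T -> R) : measurable_fun setT f ->
  cmeasurable (fun t => expi (f t)).
Proof.
move=> mf; split => /=.
- exact: (measurableT_comp measurable_cos).
- exact: (measurableT_comp measurable_sin).
Qed.

Lemma cmeasurable_real (f : T -> R) : measurable_fun setT f ->
  cmeasurable (fun t => (f t)%:C%C).
Proof. by move=> mf; split => //=. Qed.

Lemma cmeasurable_comp d' (T' : measurableType d') (f : T' -> R[i]) (h : T -> T') :
  cmeasurable f -> measurable_fun setT h -> cmeasurable (fun t => f (h t)).
Proof.
move=> [fr fi] mh; split.
- exact: (measurableT_comp fr mh).
- exact: (measurableT_comp fi mh).
Qed.

Lemma measurable_sqnormc f : cmeasurable f ->
  measurable_fun setT (fun t => sqnormc (f t)).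
Proof. by move=> [fr fi]; apply: measurable_funD; exact: measurable_funX. Qed.

Lemma measurable_sqnormcE f : cmeasurable f ->
  measurable_fun setT (fun t => (sqnormc (f t))%:E).
Proof. by move=> mf; apply/measurable_EFinP; exact: measurable_sqnormc. Qed.

End measurability.

Section integral.
Context d (T : measurableType d) (mu : {measure set T -> \bar R}).
Implicit Types f g : T -> R[i].

Definition cintegrable f :=
  mu.-integrable setT (fun t => (complex.Re (f t))%:E) /\
  mu.-integrable setT (fun t => (complex.Im (f t))%:E).

Lemma eq_cintegral D f g : f =1 g -> cintegral mu D f = cintegral mu D g.
Proof. by move=> /funext ->. Qed.

Lemma cintegrable_le f (g : T -> R) : cmeasurable f ->
  mu.-integrable setT (fun t => (g t)%:E) ->
  (forall t, Num.sqrt (sqnormc (f t)) <= g t) -> cintegrable f.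
Proof.
move=> [fr fi] gi fg; split.
- apply: (le_integrable measurableT _ _ gi); first exact/measurable_EFinP.
  move=> t _; rewrite lee_fin (le_trans (normr_Re_le _))// (le_trans (fg t))//.
  exact: ler_norm.
- apply: (le_integrable measurableT _ _ gi); first exact/measurable_EFinP.
  move=> t _; rewrite lee_fin (le_trans (normr_Im_le _))// (le_trans (fg t))//.
  exact: ler_norm.
Qed.

Lemma cintegrableM_bounded f g (k : R) : cintegrable f -> cmeasurable g ->
  (forall t, sqnormc (g t) <= k ^+ 2) -> cintegrable (fun t => f t * g t).
Proof.
move=> [fr fi] [gr gi] gk.
have rk t : `|complex.Re (g t)| <= `|k|.
  rewrite (le_trans (normr_Re_le _))// -[leRHS]sqrtr_sqr ler_wsqrtr//.
have ik t : `|complex.Im (g t)| <= `|k|.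
  rewrite (le_trans (normr_Im_le _))// -[leRHS]sqrtr_sqr ler_wsqrtr//.
split.
  under eq_fun do rewrite ReM.
  by apply: integrable_EFinB; apply: (integrable_bounded_mul (k := `|k|)).
under eq_fun do rewrite ImM.
by apply: integrable_EFinD; apply: (integrable_bounded_mul (k := `|k|)).
Qed.

Lemma cintegralZl (c : R[i]) f : cintegrable f ->
  cintegral mu setT (fun t => c * f t) = c * cintegral mu setT f.
Proof.
move=> [fr fi].
have Z (r : R) (h : T -> R) : mu.-integrable setT (fun t => (h t)%:E) ->
  mu.-integrable setT (fun t => (r * h t)%:E).
  by move=> hi; exact: (integrableZl measurableT r hi).
apply: complexP; rewrite /= ?ReM ?ImM /=.
  under eq_Rintegral do rewrite ReM.
  rewrite RintegralB//; [|exact: Z|exact: Z].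
  by rewrite !RintegralZl.
under eq_Rintegral do rewrite ImM.
rewrite RintegralD//; [|exact: Z|exact: Z].
by rewrite !RintegralZl.
Qed.

Lemma cintegralB f g : cintegrable f -> cintegrable g ->
  cintegral mu setT (fun t => f t - g t) = cintegral mu setT f - cintegral mu setT g.
Proof.
move=> [fr fi] [gr gi]; apply: complexP; rewrite /= ?ReB ?ImB /=.
  by under eq_Rintegral do rewrite ReB; rewrite RintegralB.
by under eq_Rintegral do rewrite ImB; rewrite RintegralB.
Qed.

Lemma cintegral_conj f : cintegrable f ->
  cintegral mu setT (fun t => (f t)^*%C) = (cintegral mu setT f)^*%C.
Proof.
move=> [fr fi]; apply: complexP; rewrite ?Re_conj ?Im_conj /=.
  by apply: eq_Rintegral => t _; rewrite Re_conj.
under eq_Rintegral do rewrite Im_conj -mulN1r.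
by rewrite RintegralZl// mulN1r.
Qed.

Lemma cintegral_indic D f :
  cintegral mu D f = cintegral mu setT (fun t => (\1_D t)%:C%C * f t).
Proof.
apply: complexP; rewrite /= Rintegral_mkcond; apply: eq_Rintegral => t _;
  rewrite ?ReM ?ImM /= mul0r ?subr0 ?addr0 patchE indicE;
  by case: ifPn; rewrite ?mul1r ?mul0r.
Qed.

End integral.

End complex_numbers.

(** * Fourier transform in the second variable, and the products it is applied to *)

Section partial_fourier.
Context {R : realType} {n : nat}.
Local Notation C := (R[i]).
Local Notation Rn := ('cV[R]_n).
Local Notation leb := (lebesgue_cV (R := R) n).
Local Notation leb2 := (lebesgue_cV (R := R) (n + n)).
Implicit Types (G : Rn -> Rn -> C) (f : Rn -> C) (A : 'M[R]_(n + n)).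

Local Opaque lebesgue_cV.

(** The common form of [wigner] and of [BA_truncated], so that bounds and symmetries of both are
    proved once. *)
Definition pft G (z : 'cV[R]_(n + n)) : C :=
  cintegral leb setT (fun y =>
    G (usubmx z) y * expi (- (2 * pi * dotcV (dsubmx z) y))).

Definition joint_cmeasurable G := cmeasurable (fun p : Rn * Rn => G p.1 p.2).

Lemma joint_cmeasurable_section G x : joint_cmeasurable G -> cmeasurable (G x).
Proof.
by move=> mG; apply: (cmeasurable_comp (h := pair x) mG).
Qed.

Lemma cmeasurable_phase d (T : measurableType d) (h g : T -> Rn) :
  measurable_fun setT h -> measurable_fun setT g ->
  cmeasurable (fun t => expi (- (2 * pi * dotcV (h t) (g t)))).
Proof.
move=> mh mg; apply: cmeasurable_expi; apply: measurable_funN.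
by apply: measurable_funM => //; exact: measurable_dotcV.
Qed.

Lemma cmeasurable_pft G : joint_cmeasurable G -> cmeasurable (pft G).
Proof.
move=> mG.
have [kr ki] : cmeasurable (fun q : 'cV[R]_(n + n) * Rn =>
    G (usubmx q.1) q.2 * expi (- (2 * pi * dotcV (dsubmx q.1) q.2))).
  apply: cmeasurableM.
    apply: (cmeasurable_comp (h := fun q => (usubmx q.1, q.2)) mG).
    by apply: measurable_fun_pair => //; exact: measurable_cV_usubmx.
  by apply: cmeasurable_phase => //; exact: measurable_cV_dsubmx.
split.
  exact: (measurable_Rintegral_param leb kr).
exact: (measurable_Rintegral_param leb ki).
Qed.

Lemma plancherel_cintegral (h : Rn -> C) : cintegrable leb h ->
  (\int[leb]_x (sqnormc (cintegral leb setT
     (fun y => (h y * expi (- (2 * pi * dotcV x y)))%R)))%:E <=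
   \int[leb]_y (sqnormc (h y))%:E)%E.
Proof.
move=> [hr hi]; apply: le_trans (plancherel_real hr hi).
rewrite le_eqVlt; apply/orP; left; apply/eqP; apply: eq_integral => x _.
congr EFin; rewrite /sqnormc /=; congr (_ ^+ 2 + _ ^+ 2); apply: eq_Rintegral => y _.
  by rewrite ReM /= cosN sinN mulrN opprK.
by rewrite ImM /= cosN sinN mulrN addrC.
Qed.

(** The Plancherel inequality in xi for each fixed x, integrated over x by Tonelli. *)
Lemma sqL2norm_pft_le G : joint_cmeasurable G ->
  (forall x, cintegrable leb (G x)) ->
  (sqL2norm leb2 (pft G) <= \int[leb]_x \int[leb]_y (sqnormc (G x y))%:E)%E.
Proof.
move=> mG iG.
have mpft := measurable_sqnormcE (cmeasurable_pft mG).
have p0 z : (0 <= (sqnormc (pft G z))%:E)%E by rewrite lee_fin sqnormc_ge0.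
rewrite /sqL2norm (tonelli_cV_add mpft p0).
apply: ge0_le_integral.
- by [].
- by move=> x _; exact: integral_ge0.
- apply: (measurable_fun_fubini_tonelli_F
    (fun p => (sqnormc (pft G (col_mx p.1 p.2)))%:E)); last by move=> p; exact: p0.
  apply: (measurableT_comp mpft); exact: measurable_cV_col.
- apply: (measurable_fun_fubini_tonelli_F (fun p => (sqnormc (G p.1 p.2))%:E)).
    exact: measurable_sqnormcE.
  by move=> p; rewrite lee_fin sqnormc_ge0.
move=> x _; apply: le_trans (plancherel_cintegral (iG x)).
rewrite le_eqVlt; apply/orP; left; apply/eqP; apply: eq_integral => xi _.
by rewrite /pft col_mxKu col_mxKd.
Qed.

(** The integrand of B_A(f, f) without its Fourier phase. *)
Definition ambiguity A f (x y : Rn) : C :=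
  f (ulsubmx A *m x + ursubmx A *m y) *
  (f (dlsubmx A *m x + drsubmx A *m y))^*%C.

Lemma cmeasurable_affine d (T : measurableType d) f (M1 M2 : 'M[R]_n) (h g : T -> Rn) :
  cmeasurable f -> measurable_fun setT h -> measurable_fun setT g ->
  cmeasurable (fun t => f (M1 *m h t + M2 *m g t)).
Proof.
move=> mf mh mg; apply: (cmeasurable_comp mf).
by apply: measurable_cV_add; exact: measurable_cV_mul.
Qed.

Lemma joint_cmeasurable_ambiguity A f : cmeasurable f ->
  joint_cmeasurable (ambiguity A f).
Proof.
move=> mf; apply: cmeasurableM; first exact: cmeasurable_affine.
by apply: cmeasurable_conj; exact: cmeasurable_affine.
Qed.

Lemma inL2_integrable f : inL2 leb f ->
  leb.-integrable setT (fun y => (sqnormc (f y))%:E).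
Proof.
move=> [mf foo]; apply/integrableP; split; first exact: measurable_sqnormcE.
by under eq_integral do rewrite gee0_abs ?lee_fin ?sqnormc_ge0//.
Qed.

(** Invertibility of A12 and A22 makes each factor square integrable in y for every fixed x, and |s
    t| <= |s|^2 + |t|^2 bounds the product. *)
Lemma cintegrable_ambiguity A f x : inL2 leb f ->
  ursubmx A \in unitmx -> drsubmx A \in unitmx ->
  cintegrable leb (ambiguity A f x).
Proof.
move=> f2 u1 u2; have [mf _] := f2; have fi := inL2_integrable f2.
pose g y := sqnormc (f (ulsubmx A *m x + ursubmx A *m y)) +
            sqnormc (f (dlsubmx A *m x + drsubmx A *m y)).
apply: (@cintegrable_le _ _ _ _ _ g).
- exact: joint_cmeasurable_section (joint_cmeasurable_ambiguity A mf).
- apply: integrable_EFinD.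
    have := integrable_cV_affine (ulsubmx A *m x) u1 fi.
    by apply: eq_integrable => // y _; rewrite addrC.
  have := integrable_cV_affine (dlsubmx A *m x) u2 fi.
  by apply: eq_integrable => // y _; rewrite addrC.
move=> y; rewrite /ambiguity sqnormcM sqnormc_conj.
set s := sqnormc _; set t := sqnormc _.
have s0 : 0 <= s by exact: sqnormc_ge0.
have t0 : 0 <= t by exact: sqnormc_ge0.
have -> : g y = Num.sqrt ((s + t) ^+ 2).
  by rewrite sqrtr_sqr; exact: esym (ger0_norm (addr_ge0 s0 t0)).
by rewrite ler_wsqrtr//; nra.
Qed.

(** The linear substitution by the whole matrix A turns the integrand into |f(x)|^2 |f(y)|^2, so the
    integral is a multiple of the fourth power of the L^2 norm. *)
Lemma integral_sqnormc_ambiguity A f : A \in unitmx -> inL2 leb f ->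
  (\int[leb2]_z (sqnormc (ambiguity A f (usubmx z) (dsubmx z)))%:E < +oo)%E.
Proof.
move=> Au f2; have [mf foo] := f2.
pose phi (z : 'cV[R]_(n + n)) : \bar R :=
  (sqnormc (f (usubmx z)) * sqnormc (f (dsubmx z)))%:E.
have mphi : measurable_fun setT phi.
  apply/measurable_EFinP; apply: measurable_funM.
    apply: (measurable_sqnormc (cmeasurable_comp mf _)).
    exact: measurable_cV_usubmx.
  apply: (measurable_sqnormc (cmeasurable_comp mf _)).
  exact: measurable_cV_dsubmx.
have phi0 z : (0 <= phi z)%E by rewrite lee_fin mulr_ge0 ?sqnormc_ge0.
have -> : (\int[leb2]_z (sqnormc (ambiguity A f (usubmx z) (dsubmx z)))%:E =
    \int[leb2]_z phi (A *m z))%E.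
  apply: eq_integral => z _; rewrite /phi /ambiguity sqnormcM sqnormc_conj.
  by rewrite -{5 6}[A]submxK -{5 6}[z]vsubmxK mul_block_col col_mxKu col_mxKd.
rewrite (ge0_integral_cV_linear Au mphi phi0) (tonelli_cV_add mphi phi0).
have fin : (\int[leb]_x (sqnormc (f x))%:E)%E \is a fin_num.
  by rewrite ge0_fin_numE// integral_ge0// => x _; rewrite lee_fin sqnormc_ge0.
have s0 x : (0 <= (sqnormc (f x))%:E)%E by rewrite lee_fin sqnormc_ge0.
have ms := measurable_sqnormcE mf.
have -> : (\int[leb]_x \int[leb]_y phi (col_mx x y) =
    \int[leb]_x (sqnormc (f x))%:E * \int[leb]_x (sqnormc (f x))%:E)%E.
  rewrite -ge0_integralZr; [|by []|exact: ms|by move=> x _; exact: s0|]; last first.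
    by apply: integral_ge0 => x _; exact: s0.
  apply: eq_integral => x _.
  rewrite -ge0_integralZl_EFin; [|by []|by move=> y _; exact: s0|exact: ms|exact: sqnormc_ge0].
  by apply: eq_integral => y _; rewrite /phi col_mxKu col_mxKd EFinM.
by rewrite -(fineK fin) -!EFinM ltry.
Qed.

End partial_fourier.

(** * Boxes and their volume *)

Section boxes.
Context {R : realType}.
Local Notation leb n := (lebesgue_cV (R := R) n).

Definition cV_box n (c : 'cV[R]_n) (r : R) : set 'cV[R]_n :=
  [set y | forall i, `|y i 0 - c i 0| <= r].

Lemma measurable_cV_box n (c : 'cV[R]_n) r : measurable (cV_box c r).
Proof.
rewrite (_ : cV_box c r = \bigcap_(i in [set: 'I_n])
    ((fun y : 'cV[R]_n => y i 0 : R) @^-1` `[c i 0 - r, c i 0 + r])).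
  apply: fin_bigcap_measurable => // i _; rewrite -[X in measurable X]setTI.
  exact: (measurable_cV_entry i (@measurable_id _ _ setT)).
apply/seteqP; split => [y yb i _ /=|y yb i].
  by rewrite in_itv/= -ler_distl.
by have := yb i I; rewrite /= in_itv/= -ler_distl.
Qed.

Lemma cube_box n k : cube k = cV_box (0 : 'cV[R]_n) k%:R.
Proof.
by apply/seteqP; split => y yb i; have := yb i; rewrite mxE subr0.
Qed.

Lemma measurable_cube n k : measurable (cube k : set 'cV[R]_n).
Proof. by rewrite cube_box; exact: measurable_cV_box. Qed.

Lemma lebesgue_cV_box n (c : 'cV[R]_n) r : 0 <= r ->
  leb n (cV_box c r) = ((2 * r) ^+ n)%:E.
Proof.
move=> r0.
have intE m (c' : 'cV[R]_m) :
    leb m (cV_box c' r) = (\int[leb m]_v (\1_(cV_box c' r) v)%:E)%E.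
  by rewrite integral_indic ?setIT//; exact: measurable_cV_box.
have mind m (c' : 'cV[R]_m) :
    measurable_fun setT (fun v => (\1_(cV_box c' r) v : R)%:E).
  by apply/measurable_EFinP; apply: measurable_indic; exact: measurable_cV_box.
have ind0 m (c' : 'cV[R]_m) v : (0 <= (\1_(cV_box c' r) v : R)%:E)%E.
  by rewrite lee_fin.
elim: n c => [|n IH] c; rewrite intE.
  rewrite (ge0_integral_cV0 (mind _ _) (ind0 _ _)) expr0 indicE mem_set//.
  by case.
rewrite (tonelli_cV_succ (mind _ _) (ind0 _ _)).
pose c' := \col_i c (lift ord0 i) 0.
have E t v : \1_(cV_box c r) (cV_cons (t, v)) =
    \1_(`[c 0 0 - r, c 0 0 + r]%classic) t * \1_(cV_box c' r) v :> R.
  rewrite !indicE -natrM mulnb; congr (nat_of_bool _)%:R; apply/idP/andP.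
    rewrite inE => h; split; rewrite inE /=.
      by rewrite in_itv/= -ler_distl; have := h 0; rewrite cV_cons0.
    by move=> i; have := h (lift ord0 i); rewrite cV_consS mxE.
  rewrite !inE /= in_itv/= -ler_distl => -[h0 h] i.
  case: (unliftP ord0 i) => [j ->|->]; last by rewrite cV_cons0.
  by rewrite cV_consS; have := h j; rewrite mxE.
under eq_integral => t _.
  under eq_integral do rewrite E EFinM.
  rewrite ge0_integralZl_EFin; last 4 first.
  - by [].
  - by move=> v _; exact: ind0.
  - exact: mind.
  - by [].
  rewrite -intE IH; over.
rewrite ge0_integralZr; last 4 first.
- by [].
- by apply/measurable_EFinP; apply: measurable_indic; exact: measurable_itv.
- by move=> t _; rewrite lee_fin.
- by rewrite lee_fin exprn_ge0// mulr_ge0.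
rewrite integral_indic//= setIT lebesgue_measure_itv/= lte_fin.
have [->|rn0] := eqVneq r 0.
  by rewrite subr0 addr0 ltxx mul0e mulr0 expr0n.
have rN : - r < r by rewrite (@lt_trans _ _ 0) ?oppr_lt0 ?lt0r ?rn0.
rewrite ltrD2l rN.
rewrite -EFinB -EFinM exprS; congr (_ * _)%:E.
by rewrite opprB addrC addrA subrK mulr_natl mulr2n.
Qed.

End boxes.

(** * Convergence of the truncated integrals when A12 and A22 are invertible *)

Section truncation.
Context {R : realType} {n : nat}.
Local Notation C := (R[i]).
Local Notation Rn := ('cV[R]_n).
Local Notation leb := (lebesgue_cV (R := R) n).
Local Notation leb2 := (lebesgue_cV (R := R) (n + n)).
Implicit Types (f : Rn -> C) (A : 'M[R]_(n + n)).

Definition cut (E : set Rn) (G : Rn -> Rn -> C) x y := (\1_E y)%:C%C * G x y.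

Lemma joint_cmeasurable_cut E G : measurable E -> joint_cmeasurable G ->
  joint_cmeasurable (cut E G).
Proof.
move=> mE mG; apply: cmeasurableM => //; apply: cmeasurable_real.
exact: (measurableT_comp (@measurable_indic _ _ R setT E mE) measurable_snd).
Qed.

Lemma sqnormc_cut E G x y : sqnormc (cut E G x y) = \1_E y * sqnormc (G x y).
Proof.
rewrite /cut sqnormcM sqnormc_real indicE.
by case: (_ \in _); rewrite ?expr1n ?expr0n.
Qed.

Lemma cintegrable_cut E G x : measurable E -> cintegrable leb (G x) ->
  cintegrable leb (cut E G x).
Proof.
move=> mE Gi; rewrite /cut.
under eq_fun do rewrite mulrC.
apply: (cintegrableM_bounded (k := 1) Gi).
  by apply: cmeasurable_real; exact: measurable_indic.
by move=> y; rewrite sqnormc_real indicE; case: (_ \in _); rewrite ?expr1n ?expr0n.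
Qed.

Lemma cintegrable_phase (h : Rn -> C) (xi : Rn) : cintegrable leb h ->
  cintegrable leb (fun y => h y * expi (- (2 * pi * dotcV xi y))).
Proof.
move=> hi; apply: (cintegrableM_bounded (k := 1) hi).
  exact: cmeasurable_phase.
by move=> y; rewrite sqnormc_expi expr1n.
Qed.

Lemma BA_truncatedE A f k z :
  BA_truncated A f f k z = pft (cut (cube k) (ambiguity A f)) z.
Proof.
rewrite /BA_truncated cintegral_indic; apply: eq_cintegral => y.
by rewrite /cut /ambiguity !mulrA.
Qed.

Lemma pft_truncation_error A f k z :
  (forall x, cintegrable leb (ambiguity A f x)) ->
  pft (ambiguity A f) z - BA_truncated A f f k z =
  pft (cut (~` cube k) (ambiguity A f)) z.
Proof.
move=> Gi; rewrite BA_truncatedE /pft -cintegralB; last 2 first.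
- exact: cintegrable_phase.
- by apply: cintegrable_phase; apply: cintegrable_cut => //; exact: measurable_cube.
apply: eq_cintegral => y; rewrite /cut -mulrBl; congr (_ * _).
rewrite -{1}[ambiguity _ _ _ _]mul1r -mulrBl; congr (_ * _).
rewrite !indicE in_setC; case: (_ \in _); rewrite /= ?subr0 ?subrr//.
Qed.

(** The error is the partial Fourier transform of the part with y outside the cube; the Plancherel
    inequality bounds it by a tail of an integrable function, which dominated convergence sends to
    0. *)
Lemma cvg_truncation_error A f : A \in unitmx -> ursubmx A \in unitmx ->
  drsubmx A \in unitmx -> inL2 leb f ->
  (sqL2norm leb2 (fun z => pft (ambiguity A f) z - BA_truncated A f f k z))%R
    @[k --> \oo] --> 0%E.
Proof.
move=> Au u1 u2 f2; have [mf _] := f2.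
have mG := joint_cmeasurable_ambiguity A mf.
have Gi x : cintegrable leb (ambiguity A f x) by exact: cintegrable_ambiguity.
pose F z : R := sqnormc (ambiguity A f (usubmx z) (dsubmx z)).
have mF : measurable_fun setT F.
  apply: measurable_sqnormc.
  apply: (cmeasurable_comp (h := fun z : 'cV[R]_(n + n) => (usubmx z, dsubmx z)) mG).
  by apply: measurable_fun_pair; [exact: measurable_cV_usubmx|exact: measurable_cV_dsubmx].
have F0 z : 0 <= F z by exact: sqnormc_ge0.
have Fi : leb2.-integrable setT (fun z => (F z)%:E).
  apply/integrableP; split; first exact/measurable_EFinP.
  under eq_integral do rewrite gee0_abs ?lee_fin//.
  exact: integral_sqnormc_ambiguity.
have mC k : measurable (~` cube k : set Rn).
  by apply: measurableC; exact: measurable_cube.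
pose H k z : \bar R := (\1_(~` cube k) (dsubmx z) * F z)%:E.
have mH k : measurable_fun setT (H k).
  apply/measurable_EFinP; apply: measurable_funM => //.
  apply: (measurableT_comp (@measurable_indic _ _ R setT _ (mC k))).
  exact: measurable_cV_dsubmx.
have H0 k z : (0 <= H k z)%E by rewrite lee_fin mulr_ge0.
have lim0 : (\int[leb2]_z H k z)%E @[k --> \oo] --> 0%E.
  have := @dominated_convergence _ _ _ leb2 setT measurableT H (cst 0%E)
    (fun z => (F z)%:E) mH.
  case => //.
  - apply: aeW => z _; apply: cvg_near_cst.
    (* Once k exceeds the sum of the absolute values of its coordinates, y lies in the cube. *)
    near=> k; rewrite /H indicE memNset ?mul0r//=; apply => i.
    apply: (@le_trans _ _ (\sum_j `|dsubmx z j 0|)).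
      by rewrite (bigD1 i)//= lerDl sumr_ge0.
    by near: k; exact: nbhs_infty_ger.
  - apply: aeW => z k _.
    rewrite gee0_abs// lee_fin ler_piMl// indicE lern1 leq_b1//.
  - by move=> _ _; rewrite integral0.
apply: squeeze_cvge lim0; last exact: cvg_cst.
apply: nearW => k; apply/andP; split.
  by apply: integral_ge0 => z _; rewrite lee_fin sqnormc_ge0.
rewrite /sqL2norm; under eq_integral do rewrite pft_truncation_error//.
apply: le_trans (sqL2norm_pft_le _ _) _.
- exact: joint_cmeasurable_cut.
- by move=> x; exact: cintegrable_cut.
rewrite (tonelli_cV_add (mH k) (H0 k)).
rewrite le_eqVlt; apply/orP; left; apply/eqP.
apply: eq_integral => x _; apply: eq_integral => y _.
by rewrite sqnormc_cut /H /F col_mxKu col_mxKd.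
Unshelve. all: by end_near. Qed.

Lemma is_BA_pft A f : A \in unitmx -> ursubmx A \in unitmx ->
  drsubmx A \in unitmx -> inL2 leb f -> is_BA A f f (pft (ambiguity A f)).
Proof.
move=> Au u1 u2 f2; split; last exact: cvg_truncation_error.
by apply: cmeasurable_pft; apply: joint_cmeasurable_ambiguity; case: f2.
Qed.

End truncation.

(** * The Wigner function as B_A, and the sufficiency of the stated form *)

Section wigner_as_partial_fourier.
Context {R : realType} {n : nat}.
Local Notation C := (R[i]).
Local Notation Rn := ('cV[R]_n).
Local Notation leb := (lebesgue_cV (R := R) n).
Local Notation leb2 := (lebesgue_cV (R := R) (n + n)).
Implicit Types (f : Rn -> C) (A : 'M[R]_(n + n)).

(** The matrix A for which B_A f is the Wigner function itself. *)
Definition wigner_mx : 'M[R]_(n + n) :=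
  block_mx 1%:M (2^-1)%:M 1%:M (- 2^-1)%:M.

Lemma half_double : 2^-1 + 2^-1 = 1 :> R. Proof. by field. Qed.

Lemma wigner_mx_unit : wigner_mx \in unitmx.
Proof.
have : wigner_mx *m block_mx (2^-1)%:M (2^-1)%:M 1%:M (- 1%:M) = 1%:M.
  rewrite mulmx_block !mul1mx !mulmxN !mulmx1 (raddfN (@scalar_mx R n))/=.
  by rewrite !subrr opprK -raddfD/= half_double -scalar_mx_block.
by case/mulmx1_unit.
Qed.

Lemma scalar_unitmx (a : R) : a != 0 -> a%:M \in (unitmx : {pred 'M[R]_n}).
Proof. by move=> a0; rewrite unitmxE det_scalar unitrX// unitfE. Qed.

Lemma wignerE f z : wigner f z = pft (ambiguity wigner_mx f) z.
Proof.
apply: eq_cintegral => y; rewrite /ambiguity /wigner_mx.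
rewrite block_mxKul block_mxKur block_mxKdl block_mxKdr !mul1mx !mul_scalar_mx.
by rewrite scaleNr.
Qed.

Lemma cintegrable_wigner f x : inL2 leb f ->
  cintegrable leb (ambiguity wigner_mx f x).
Proof.
move=> f2; apply: cintegrable_ambiguity => //.
- by rewrite block_mxKur scalar_unitmx// invr_eq0 pnatr_eq0.
- by rewrite block_mxKdr scalar_unitmx// oppr_eq0 invr_eq0 pnatr_eq0.
Qed.

Lemma cmeasurable_wigner f : cmeasurable f -> cmeasurable (wigner f).
Proof.
move=> mf; rewrite (_ : wigner f = pft (ambiguity wigner_mx f)).
  by apply: cmeasurable_pft; exact: joint_cmeasurable_ambiguity.
by apply/funext => z; exact: wignerE.
Qed.

(** Makes |W f|^2 an integrable density, as the invariance arguments below require. *)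
Lemma sqL2norm_wigner f : inL2 leb f -> (sqL2norm leb2 (wigner f) < +oo)%E.
Proof.
move=> f2; have [mf _] := f2.
rewrite (_ : wigner f = pft (ambiguity wigner_mx f)); last first.
  by apply/funext => z; exact: wignerE.
have mG := joint_cmeasurable_ambiguity wigner_mx mf.
apply: le_lt_trans (sqL2norm_pft_le mG _) _.
  by move=> x; exact: cintegrable_wigner.
apply: le_lt_trans (integral_sqnormc_ambiguity wigner_mx_unit f2).
rewrite tonelli_cV_add; last 2 first.
- apply: measurable_sqnormcE.
  apply: (cmeasurable_comp (h := fun z : 'cV[R]_(n + n) => (usubmx z, dsubmx z)) mG).
  by apply: measurable_fun_pair; [exact: measurable_cV_usubmx|exact: measurable_cV_dsubmx].
- by move=> z; rewrite lee_fin sqnormc_ge0.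
rewrite le_eqVlt; apply/orP; left; apply/eqP.
by apply: eq_integral => x _; apply: eq_integral => y _; rewrite col_mxKu col_mxKd.
Qed.

Lemma cintegral_cV_linear (M : 'M[R]_n) (h : Rn -> C) : M \in unitmx ->
  cintegrable leb h ->
  cintegral leb setT (fun y => h (M *m y)) =
  (`|\det M|^-1)%:C%C * cintegral leb setT h.
Proof.
move=> Mu [hr hi].
have S (g : Rn -> R) : leb.-integrable setT (fun y => (g y)%:E) ->
    \int[leb]_y g (M *m y) = `|\det M|^-1 * \int[leb]_y g y.
  move=> gi; have := integral_cV_affine 0 Mu gi.
  under eq_integral do rewrite addr0.
  move=> E; apply: EFin_inj; rewrite EFinM !fineK ?E//.
  - exact: integrable_fin_num.
  - by apply: fin_numM => //; exact: integrable_fin_num.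
apply: complexP; rewrite /= ?ReM ?ImM /= mul0r ?subr0 ?addr0.
  exact: (S (fun y => complex.Re (h y))).
exact: (S (fun y => complex.Im (h y))).
Qed.

Lemma dotcV_mx (u v : Rn) : dotcV u v = (u^T *m v) 0 0.
Proof. by rewrite mxE; apply: eq_bigr => i _; rewrite mxE. Qed.

Lemma dotcV_mull (M : 'M[R]_n) (u v : Rn) : dotcV (M *m u) v = dotcV u (M^T *m v).
Proof. by rewrite !dotcV_mx trmx_mul mulmxA. Qed.

Lemma wigner_theta_perturbation (S1 S2 : 'M[R]_(n + n)) (A11 A22 C1 D2 : 'M[R]_n) :
  perturbation_form S1 S2 A11 A22 C1 D2 ->
  linear_perturbation_by (wigner_theta S1 S2) (block_mx A11 (- A22) A11 A22).
Proof.
move=> [[u1 u2] _ _ -> ->].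
have Au : block_mx A11 (- A22) A11 A22 \in unitmx.
  have : block_mx A11 (- A22) A11 A22 *m
     (2^-1 *: block_mx (invmx A11) (invmx A11) (- invmx A22) (invmx A22)) = 1%:M.
    rewrite -scalemxAr mulmx_block !mulNmx !mulmxN !mulmxV// opprK.
    rewrite !subrr scale_block_mx !scaler0 scalerDr -scalerDl half_double.
    by rewrite scale1r -scalar_mx_block.
  by case/mulmx1_unit.
have uN : - A22 \in unitmx by rewrite -scaleN1r unitmxZ// unitrN1.
split => //; exists `|\det A11| => f f2.
exists (pft (ambiguity (block_mx A11 (- A22) A11 A22) f)).
  by apply: is_BA_pft; rewrite ?block_mxKur ?block_mxKdr.
apply: aeW => z.
(* [M] is the matrix of the substitution. [D12] is block diagonal with blocks A11^-1 and [M^T], so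
   |det M| cancels between its determinant and the Jacobian, leaving N = |det A11|. *)
pose M : 'M[R]_n := -2 *: A22.
have Mu : M \in unitmx by rewrite unitmxZ// unitfE oppr_eq0 pnatr_eq0.
have MTu : M^T \in unitmx by rewrite unitmx_tr.
have -> : wigner_theta (block_mx (invmx A11) 0 C1 A11^T)
    (block_mx 0 (-2 *: A22^T) (2^-1 *: invmx A22) D2) f z =
    (`|\det (invmx A11) * \det M|^-1)%:C%C *
    wigner f (col_mx (A11 *m usubmx z) (invmx M^T *m dsubmx z)).
  rewrite /wigner_theta /D12 !(block_mxKul, block_mxKur).
  have -> : -2 *: A22^T = M^T by rewrite /M linearZ.
  rewrite det_ublock det_tr; congr (_ * wigner f _).
  have Du : block_mx (invmx A11) 0 0 M^T \in unitmx.
    by rewrite unitmxE det_ublock unitrM -!unitmxE unitmx_inv u1.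
  apply: (can_inj (mulKmx Du)); rewrite mulKVmx//.
  by rewrite mul_block_col !mul0mx addr0 add0r mulKmx// mulKVmx// vsubmxK.
pose h y := ambiguity wigner_mx f (A11 *m usubmx z) y *
  expi (- (2 * pi * dotcV (invmx M^T *m dsubmx z) y)).
have -> : wigner f (col_mx (A11 *m usubmx z) (invmx M^T *m dsubmx z)) =
    cintegral leb setT h.
  by rewrite wignerE /pft col_mxKu col_mxKd.
have hi : cintegrable leb h.
  by apply: cintegrable_phase; exact: cintegrable_wigner.
have -> : pft (ambiguity (block_mx A11 (- A22) A11 A22) f) z =
    cintegral leb setT (fun y => h (M *m y)).
  apply: eq_cintegral => y; rewrite /h /ambiguity /wigner_mx.
  rewrite !(block_mxKul, block_mxKur, block_mxKdl, block_mxKdr) !mul1mx.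
  rewrite !mul_scalar_mx dotcV_mull trmx_inv trmxK mulKmx//.
  rewrite /M -scalemxAl !scalerA !mulrN !mulNr opprK mulVf ?pnatr_eq0//.
  by rewrite scaleN1r scale1r mulNmx.
rewrite (cintegral_cV_linear Mu hi) mulrA -rmorphM /=; congr (_%:C%C * _).
by rewrite normrM invfM det_inv normfV invrK.
Qed.

End wigner_as_partial_fourier.

(** * Symmetries of the Wigner transform *)

Section almost_everywhere.
Context {R : realType} {n : nat}.
Local Notation C := (R[i]).
Local Notation Rn := ('cV[R]_n).
Local Notation leb := (lebesgue_cV (R := R) n).

Lemma ge0_integral_eq0_ae (q : Rn -> R) : measurable_fun setT q ->
  (forall z, 0 <= q z) -> (\int[leb]_z (q z)%:E <= 0)%E ->
  {ae leb, forall z, q z = 0}.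
Proof.
move=> mq q0 h.
have mqE : measurable_fun setT (fun z => (q z)%:E) by exact/measurable_EFinP.
have : (\int[leb]_z `|(q z)%:E| = 0)%E.
  under eq_integral do rewrite gee0_abs ?lee_fin//.
  by apply/eqP; rewrite eq_le h integral_ge0// => z _; rewrite lee_fin.
move/(ae_eq_integral_abs leb measurableT mqE) => E.
by apply: filterS E => z /(_ I) [].
Qed.

(** The L^2 distance between |G| and |F| composed with the affine map is controlled, for every k, by
    the distances of G to [b k] and of F to [a k], the latter up to the Jacobian. Both tend to 0, so
    the fixed quantity is 0. *)
Lemma sqnormc_L2_limits_ae (a b : nat -> Rn -> C) (F G : Rn -> C)
    (M : 'M[R]_n) (c : Rn) : M \in unitmx ->
  (forall k, cmeasurable (a k)) -> (forall k, cmeasurable (b k)) ->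
  cmeasurable F -> cmeasurable G ->
  (forall k z, sqnormc (b k z) = sqnormc (a k (M *m z + c))) ->
  (sqL2norm leb (fun z => F z - a k z))%R @[k --> \oo] --> 0%E ->
  (sqL2norm leb (fun z => G z - b k z))%R @[k --> \oo] --> 0%E ->
  {ae leb, forall z, sqnormc (G z) = sqnormc (F (M *m z + c))}.
Proof.
move=> Mu ma mb mF mG ba Fa Gb.
pose T z := M *m z + c; pose m (w : C) := Num.sqrt (sqnormc w).
have mT : measurable_fun setT T by exact: measurable_cV_affine.
have mFT : cmeasurable (F \o T) by exact: (cmeasurable_comp mF mT).
have mm (f : Rn -> C) : cmeasurable f -> measurable_fun setT (m \o f).
  have ms : measurable_fun setT (Num.sqrt : R -> R).
    by apply: continuous_measurable_fun; exact: sqrt_continuous.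
  by move=> mf; exact: (measurableT_comp ms (measurable_sqnormc mf)).
pose q z := (m (G z) - m (F (T z))) ^+ 2.
have mq : measurable_fun setT q.
  by apply: measurable_funX; apply: measurable_funB; [exact: (mm G)|exact: (mm (F \o T))].
have q0 z : 0 <= q z by exact: sqr_ge0.
pose r : \bar R := (`|\det M|^-1)%:E.
have bound k : (\int[leb]_z (q z)%:E <=
    2%:E * sqL2norm leb (fun z => (G z - b k z)%R) +
    2%:E * (r * sqL2norm leb (fun z => (F z - a k z)%R)))%E.
  have mGb := measurable_sqnormcE (cmeasurableB mG (mb k)).
  have mFa := measurable_sqnormcE (cmeasurableB mF (ma k)).
  have mFaT := measurableT_comp mFa mT.
  rewrite /sqL2norm /r -(ge0_integral_cV_affine c Mu mFa); last first.
    by move=> z; rewrite lee_fin sqnormc_ge0.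
  rewrite -!ge0_integralZl_EFin//; last 2 first.
  - by move=> z _; rewrite lee_fin sqnormc_ge0.
  - by move=> z _; rewrite lee_fin sqnormc_ge0.
  rewrite -ge0_integralD//; last 4 first.
  - by move=> z _; rewrite lee_fin mulr_ge0 ?sqnormc_ge0.
  - exact: measurable_funeM.
  - by move=> z _; rewrite lee_fin mulr_ge0 ?sqnormc_ge0.
  - exact: measurable_funeM.
  apply: ge0_le_integral; [by []|by move=> z _; rewrite lee_fin| | |].
  - exact/measurable_EFinP.
  - by apply: emeasurable_funD; exact: measurable_funeM.
  move=> z _; rewrite lee_fin.
  (* The common modulus t of [b k z] and [a k (T z)] is inserted: (x - y)^2 <= 2 (x - t)^2 + 2 (y -
     t)^2. *)
  apply: le_trans (_ : _ <= 2 * (m (G z) - m (b k z)) ^+ 2 +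
     2 * (m (F (T z)) - m (a k (T z))) ^+ 2) _.
    rewrite /q /m ba -/(T z) -/(m (a k (T z))).
    move: (Num.sqrt _) (Num.sqrt _) (m _) => x y t.
    by have := sqr_ge0 (x - t + (y - t)); nra.
  by rewrite lerD// ler_pM2l// sqr_norm_sub_le.
have q00 : (\int[leb]_z (q z)%:E <= 0)%E.
  have L : (2%:E * sqL2norm leb (fun z => (G z - b k z)%R) +
    2%:E * (r * sqL2norm leb (fun z => (F z - a k z)%R)) @[k --> \oo] --> 0)%E.
    rewrite -[X in _ --> X](adde0 0%E); apply: cvgeD => //.
      by rewrite -(mule0 2%:E); apply: cvgeZl.
    rewrite -(mule0 2%:E); apply: cvgeZl => //.
    by rewrite -(mule0 r); apply: cvgeZl.
  rewrite -(cvg_lim _ L)//; apply: lime_ge; first by apply/cvg_ex; exists 0%E.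
  exact: nearW.
have Q := ge0_integral_eq0_ae mq q0 q00.
apply: filterS Q => z /eqP; rewrite sqrf_eq0 subr_eq0 => /eqP E.
have := congr1 (fun x => x ^+ 2) E.
by rewrite !sqr_sqrtr ?sqnormc_ge0.
Qed.

(* [(M z + c) i = z i + l z] with [l] invariant: on [l <> 0] all orbits leave
   every slab [|z i| <= N], so an integrable invariant density vanishes there. *)
Lemma integrable_invariant_ae0 (g l : Rn -> R) (M : 'M[R]_n) (c : Rn) (i : 'I_n) :
  `|\det M| = 1 -> measurable_fun setT g -> (forall z, 0 <= g z) ->
  (\int[leb]_z (g z)%:E < +oo)%E -> measurable_fun setT l ->
  (forall z, (M *m z + c) i 0 = z i 0 + l z) ->
  (forall z, l (M *m z + c) = l z) ->
  {ae leb, forall z, g (M *m z + c) = g z} ->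
  {ae leb, forall z, l z != 0 -> g z = 0}.
Proof.
move=> detM mg g0 goo ml Ti lT gT.
have Mu : M \in unitmx by rewrite unitmxE unitfE -normr_eq0 detM oner_neq0.
pose T z := M *m z + c.
have mT : measurable_fun setT T by exact: measurable_cV_affine.
have iterS k z : iter k.+1 T z = iter k T (T z) by exact: iterSr.
have mit k : measurable_fun setT (iter k T).
  elim: k => [|k IH]; first exact: measurable_id.
  exact: (measurableT_comp mT IH).
have intT k (f : Rn -> \bar R) : measurable_fun setT f -> (forall z, 0 <= f z)%E ->
    (\int[leb]_z f (iter k T z) = \int[leb]_z f z)%E.
  move=> mf f0; elim: k => [//|k IH].
  under eq_integral do rewrite iterS.
  rewrite (ge0_integral_cV_affine c Mu (f := fun z => f (iter k T z)))//.
    by rewrite detM invr1 mul1e IH.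
  exact: (measurableT_comp mf (mit k)).
have itl k z : l (iter k T z) = l z by elim: k => //= k IH; rewrite lT IH.
have iti k z : (iter k T z) i 0 = z i 0 + k%:R * l z.
  elim: k => [|k IH]; first by rewrite mul0r addr0.
  by rewrite /= Ti itl IH -natr1 mulrDl mul1r addrA.
have gk k : {ae leb, forall z, g (iter k T z) = g z}.
  elim: k => [|k IH]; first exact: aeW.
  have := ae_cV_affine c Mu IH; apply: filterS2 gT => z gz gkz.
  by rewrite iterS /T gkz.
pose E : set Rn := [set z | l z != 0].
have mE : measurable E.
  rewrite (_ : E = ~` (l @^-1` [set 0])).
    by apply: measurableC; rewrite -[X in measurable X]setTI; exact: ml.
  by apply/seteqP; split => z /= /eqP.
pose W (N : nat) : set Rn := [set z | `|z i 0| <= N%:R].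
have mW N : measurable (W N).
  rewrite (_ : W N = (fun z : Rn => z i 0 : R) @^-1` `[- N%:R, N%:R]).
    rewrite -[X in measurable X]setTI.
    exact: (measurable_cV_entry i (@measurable_id _ _ setT)).
  by apply/seteqP; split => z /=; rewrite in_itv/= -ler_norml.
pose h N z : R := g z * \1_(E `&` W N) z.
have mh N : measurable_fun setT (h N).
  by apply: measurable_funM => //; apply: measurable_indic; exact: measurableI.
have h0 N z : 0 <= h N z by rewrite mulr_ge0.
have gi : leb.-integrable setT (fun z => (g z)%:E).
  apply/integrableP; split; first exact/measurable_EFinP.
  by under eq_integral do rewrite gee0_abs ?lee_fin//.
(* [h N] is g cut to the slab and to l <> 0. Its integral along the iterates of T is constant
   because |det M| = 1, and tends to 0 by dominated convergence; g itself dominates because it is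
   invariant. *)
have hint0 N : (\int[leb]_z (h N z)%:E <= 0)%E.
  pose H (k : nat) z : \bar R := (h N (iter k T z))%:E.
  have mH k : measurable_fun setT (H k).
    by apply/measurable_EFinP; exact: (measurableT_comp (mh N) (mit k)).
  have lim0 : (\int[leb]_z H k z)%E @[k --> \oo] --> 0%E.
    have := @dominated_convergence _ _ _ leb setT measurableT H (cst 0%E)
      (fun z => (g z)%:E) mH.
    case => //.
    - apply: aeW => z _; apply: cvg_near_cst.
      have [lz|lz] := eqVneq (l z) 0.
        apply: nearW => k; rewrite /H /h indicE memNset ?mulr0//= => -[+ _].
        by rewrite /E /= itl lz eqxx.
      near=> k; rewrite /H /h indicE memNset ?mulr0//= => -[_].
      rewrite /W/= iti; apply/negP; rewrite -ltNge.
      (* From this k on, the displacement k |l z| exceeds N + |z i|, which pushes the orbit out of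
         the slab. *)
      have hk : (N%:R + `|z i 0| + 1) / `|l z| <= k%:R.
        by near: k; exact: nbhs_infty_ger.
      rewrite ler_pdivrMr ?normr_gt0// in hk.
      have := lerB_normD (k%:R * l z) (z i 0); rewrite normrM normr_nat (addrC _ (z i 0)).
      by move: hk; lra.
    - apply: filterS (ae_foralln gk) => z gz k _.
      rewrite gee0_abs ?lee_fin// /h gz ler_piMr// indicE lern1 leq_b1//.
    - by move=> _ _; rewrite integral0.
  have cst k : (\int[leb]_z H k z = \int[leb]_z (h N z)%:E)%E.
    apply: (intT k (fun z => (h N z)%:E)); first exact/measurable_EFinP.
    by move=> z; rewrite lee_fin.
  have lim1 : (\int[leb]_z H k z)%E @[k --> \oo] --> (\int[leb]_z (h N z)%:E)%E.
    by apply: cvg_near_cst; apply: nearW.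
  by rewrite (cvg_unique _ lim1 lim0).
have := ae_foralln (fun N => ge0_integral_eq0_ae (mh N) (h0 N) (hint0 N)).
apply: filterS => z hz lz.
have [N Nz] : exists N : nat, `|z i 0| <= N%:R.
  exists (Num.bound `|z i 0|); exact/ltW/archi_boundP.
by have := hz N; rewrite /h indicE mem_set ?mulr1.
Unshelve. all: by end_near. Qed.

End almost_everywhere.

(** * Modulation and frequency reversal, for W and for the truncated integrals *)

Section wigner_symmetries.
Context {R : realType} {n : nat}.
Local Notation C := (R[i]).
Local Notation Rn := ('cV[R]_n).
Local Notation R2n := ('cV[R]_(n + n)).
Local Notation leb := (lebesgue_cV (R := R) n).
Local Notation leb2 := (lebesgue_cV (R := R) (n + n)).
Implicit Types (f : Rn -> C) (G : Rn -> Rn -> C) (A : 'M[R]_(n + n)).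

Definition modulate (eta : Rn) f (y : Rn) := f y * expi (2 * pi * dotcV eta y).

Definition frequency_flip : 'M[R]_(n + n) := block_mx 1%:M 0 0 (- 1%:M).

Lemma dotcVNl (u v : Rn) : dotcV (- u) v = - dotcV u v.
Proof. by rewrite /dotcV -sumrN; apply: eq_bigr => i _; rewrite mxE mulNr. Qed.

Lemma dotcVDl (u v w : Rn) : dotcV (u + v) w = dotcV u w + dotcV v w.
Proof. by rewrite /dotcV -big_split; apply: eq_bigr => i _; rewrite mxE mulrDl. Qed.

Lemma dotcVDr (u v w : Rn) : dotcV u (v + w) = dotcV u v + dotcV u w.
Proof. by rewrite /dotcV -big_split; apply: eq_bigr => i _; rewrite mxE mulrDr. Qed.

Lemma cmeasurable_modulate eta f : cmeasurable f -> cmeasurable (modulate eta f).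
Proof.
move=> mf; apply: cmeasurableM => //; apply: cmeasurable_expi.
by apply: measurable_funM => //; exact: measurable_dotcV.
Qed.

Lemma sqnormc_modulate eta f y : sqnormc (modulate eta f y) = sqnormc (f y).
Proof. by rewrite /modulate sqnormcM sqnormc_expi mulr1. Qed.

Lemma inL2_modulate eta f : inL2 leb f -> inL2 leb (modulate eta f).
Proof.
move=> [mf foo]; split; first exact: cmeasurable_modulate.
by rewrite /sqL2norm; under eq_integral do rewrite sqnormc_modulate.
Qed.

(** When G is real, conjugating the integral only reverses the sign of the frequency. *)
Lemma pft_flip G (z : R2n) : (forall x y, (G x y)^*%C = G x y) ->
  (forall x, cintegrable leb (G x)) ->
  sqnormc (pft G (frequency_flip *m z)) = sqnormc (pft G z).
Proof.
move=> Gr Gi; rewrite -[RHS]sqnormc_conj; congr sqnormc.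
rewrite /pft -cintegral_conj; last exact: cintegrable_phase.
rewrite /frequency_flip -{1 2}[z]vsubmxK mul_block_col !mul0mx mul1mx addr0 add0r.
rewrite col_mxKu col_mxKd mulNmx mul1mx; apply: eq_cintegral => y.
by rewrite conjcM Gr conj_expi dotcVNl mulrN.
Qed.

(** A phase linear in y shifts the frequency by kap, while a phase depending on x alone leaves the
    integral and has modulus 1. *)
Lemma pft_modulate G (al : Rn -> R) (kap : Rn) (z : R2n) :
  cintegrable leb (G (usubmx z)) ->
  sqnormc (pft (fun x y => expi (al x) * (G x y * expi (2 * pi * dotcV kap y))) z) =
  sqnormc (pft G (1%:M *m z + col_mx 0 (- kap))).
Proof.
move=> Gi.
have zE : 1%:M *m z + col_mx 0 (- kap) = col_mx (usubmx z) (dsubmx z - kap).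
  by rewrite mul1mx -{1}[z]vsubmxK add_col_mx addr0.
rewrite zE.
have -> : pft (fun x y => expi (al x) * (G x y * expi (2 * pi * dotcV kap y))) z =
    expi (al (usubmx z)) * pft G (col_mx (usubmx z) (dsubmx z - kap)).
  rewrite /pft col_mxKu col_mxKd -cintegralZl; last exact: cintegrable_phase.
  apply: eq_cintegral => y; rewrite -!mulrA -expiD; congr (_ * (_ * expi _)).
  by rewrite dotcVDl dotcVNl; ring.
by rewrite sqnormcM sqnormc_expi mul1r.
Qed.

(** The matrix K of the overview: modulating f by eta contributes the phase eta . (A12 - A22) y,
    that is (K eta) . y. For [wigner_mx] it is the identity. *)
Definition ambiguity_shift A : 'M[R]_n := (ursubmx A - drsubmx A)^T.

Lemma ambiguity_modulate A eta f x y :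
  ambiguity A (modulate eta f) x y =
  expi (2 * pi * dotcV eta ((ulsubmx A - dlsubmx A) *m x)) *
  (ambiguity A f x y * expi (2 * pi * dotcV (ambiguity_shift A *m eta) y)).
Proof.
rewrite /ambiguity /modulate conjcM conj_expi.
set p := f _; set q := (f _)^*%C; rewrite mulrACA [RHS]mulrCA; congr (_ * _).
rewrite -!expiD; congr expi; rewrite /ambiguity_shift dotcV_mull trmxK.
by rewrite !mulmxBl !dotcVBr !dotcVDr; ring.
Qed.

Lemma sqnormc_wigner_modulate eta f z : inL2 leb f ->
  sqnormc (wigner (modulate eta f) z) =
  sqnormc (wigner f (1%:M *m z + col_mx 0 (- eta))).
Proof.
move=> f2; rewrite !wignerE.
apply: etrans (pft_modulate
  (fun x => 2 * pi * dotcV eta ((ulsubmx wigner_mx - dlsubmx wigner_mx) *m x)) _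
  (cintegrable_wigner (usubmx z) f2)).
congr sqnormc; apply: eq_cintegral => y; congr (_ * _).
rewrite ambiguity_modulate; congr (_ * (_ * expi (_ * dotcV _ _))).
rewrite /ambiguity_shift /wigner_mx block_mxKur block_mxKdr.
by rewrite -raddfB/= opprK half_double trmx1 mul1mx.
Qed.

(** Boundedness of f and the finite volume of the cube replace the invertibility of A12 and A22, so
    this holds for the unknown A of the converse. *)
Lemma cintegrable_cut_bounded k A f x : cmeasurable f ->
  (forall y, sqnormc (f y) <= 1) ->
  cintegrable leb (cut (cube k) (ambiguity A f) x).
Proof.
move=> mf f1; apply: (@cintegrable_le _ _ _ _ _ (\1_(cube k))).
- apply: joint_cmeasurable_section; apply: joint_cmeasurable_cut.
    exact: measurable_cube.
  exact: joint_cmeasurable_ambiguity.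
- apply/integrableP; split.
    by apply/measurable_EFinP; apply: measurable_indic; exact: measurable_cube.
  under eq_integral do rewrite gee0_abs ?lee_fin//.
  rewrite integral_indic ?setIT//; last exact: measurable_cube.
  rewrite cube_box; apply: le_lt_trans (ltry ((2 * k%:R) ^+ n)).
  by rewrite le_eqVlt; apply/orP; left; apply/eqP; exact: lebesgue_cV_box.
move=> y; rewrite sqnormc_cut /ambiguity sqnormcM sqnormc_conj.
rewrite indicE; case: (_ \in _); rewrite ?mul0r ?sqrtr0// mul1r.
rewrite -[leRHS]sqrtr1 ler_wsqrtr// -[leRHS]mulr1 ler_pM ?sqnormc_ge0//.
Qed.

Lemma sqnormc_BA_modulate A eta f k z : cmeasurable f ->
  (forall y, sqnormc (f y) <= 1) ->
  sqnormc (BA_truncated A (modulate eta f) (modulate eta f) k z) =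
  sqnormc (BA_truncated A f f k (1%:M *m z + col_mx 0 (- (ambiguity_shift A *m eta)))).
Proof.
move=> mf f1; rewrite !BA_truncatedE.
apply: etrans (pft_modulate
  (fun x => 2 * pi * dotcV eta ((ulsubmx A - dlsubmx A) *m x)) _
  (cintegrable_cut_bounded k A (usubmx z) mf f1)).
congr sqnormc; apply: eq_cintegral => y; congr (_ * _).
by rewrite /cut ambiguity_modulate !mulrA (mulrC (_%:C%C)).
Qed.

Lemma sqnormc_BA_flip A f k z : cmeasurable f ->
  (forall y, sqnormc (f y) <= 1) -> (forall y, (f y)^*%C = f y) ->
  sqnormc (BA_truncated A f f k (frequency_flip *m z)) =
  sqnormc (BA_truncated A f f k z).
Proof.
move=> mf f1 fr; rewrite !BA_truncatedE pft_flip//.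
  by move=> x y; rewrite /cut /ambiguity !conjcM conjcK !fr conjc_real.
by move=> x; exact: cintegrable_cut_bounded.
Qed.

Lemma sqnormc_wigner_flip f z : inL2 leb f -> (forall y, (f y)^*%C = f y) ->
  sqnormc (wigner f (frequency_flip *m z)) = sqnormc (wigner f z).
Proof.
move=> f2 fr; rewrite !wignerE pft_flip//.
  by move=> x y; rewrite /ambiguity !conjcM conjcK !fr.
by move=> x; exact: cintegrable_wigner.
Qed.

End wigner_symmetries.

(** * The test function, and the invariances that its Wigner function excludes *)

Section cube_indicator.
Context {R : realType} {n : nat}.
Local Notation C := (R[i]).
Local Notation Rn := ('cV[R]_n).
Local Notation R2n := ('cV[R]_(n + n)).
Local Notation leb := (lebesgue_cV (R := R) n).
Local Notation leb2 := (lebesgue_cV (R := R) (n + n)).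

(** This function meets all demands at once: bounded, so that truncations converge for every A;
    real, so that frequency reversal applies; square integrable; and with a Wigner function that is
    easily bounded below near 0. *)
Definition cube1 (y : Rn) : C := (\1_(cube 1) y)%:C%C.

Lemma cmeasurable_cube1 : cmeasurable cube1.
Proof.
by apply: cmeasurable_real; apply: measurable_indic; exact: measurable_cube.
Qed.

Lemma cube1_le1 y : sqnormc (cube1 y) <= 1.
Proof.
by rewrite sqnormc_real indicE; case: (_ \in _); rewrite ?expr1n ?expr0n.
Qed.

Lemma cube1_real y : (cube1 y)^*%C = cube1 y.
Proof. exact: conjc_real. Qed.

Lemma cube_measure k : leb (cube k) = ((2 * k%:R) ^+ n)%:E.
Proof. by rewrite cube_box; exact: lebesgue_cV_box. Qed.

Lemma inL2_cube1 : inL2 leb cube1.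
Proof.
split; first exact: cmeasurable_cube1.
rewrite /sqL2norm (_ : (fun t => _) = fun t => (\1_(cube 1) t : R)%:E).
  rewrite integral_indic ?setIT//; last exact: measurable_cube.
  apply: le_lt_trans (ltry ((2 * 1%:R) ^+ n)).
  by rewrite le_eqVlt; apply/orP; left; apply/eqP; exact: cube_measure.
apply/funext => t; rewrite sqnormc_real indicE.
by case: (_ \in _); rewrite ?expr1n ?expr0n.
Qed.

Lemma cos_ge_half : exists2 d : R, 0 < d & forall t, `|t| <= d -> 2^-1 <= cos t.
Proof.
have := @continuous_cos R 0; move/cvgrPdist_le => /(_ 2^-1).
rewrite invr_gt0 ltr0n => /(_ isT) [e /= e0 He].
exists (e / 2); first by rewrite divr_gt0.
move=> t te; have := He t; rewrite /ball_ /= sub0r normrN cos0.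
have /[swap]/[apply] : `|t| < e.
  by rewrite (le_lt_trans te)// ltr_pdivrMr// ltr_pMr// ltr1n.
by rewrite ler_distlC => /andP[+ _]; lra.
Qed.

(** For z = (u, v) near 0 the product of indicators vanishes unless |y_i| <= 2, and there the phase
    has cosine at least 1/2. Since the product equals 1 on the unit cube, the real part is at least
    half the volume of that cube. *)
Lemma wigner_cube1_gt0 : exists2 d : R, 0 < d &
  forall z : R2n, cV_box 0 d z -> 0 < sqnormc (wigner cube1 z).
Proof.
have [d0 d00 Hcos] := cos_ge_half.
(* The phase is at most 2 pi n (2 d) <= d K; using n + 1 in place of n keeps K positive in dimension
   0. The bound d <= 1/2 keeps u + y/2 and u - y/2 in the unit cube for every y in it. *)
pose K : R := 4 * pi * n.+1%:R.
have K0 : 0 < K by rewrite !mulr_gt0// ?pi_gt0.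
pose d := Num.min 2^-1 (d0 / K).
have dgt0 : 0 < d by rewrite lt_min invr_gt0 ltr0n divr_gt0.
have d12 : d <= 2^-1 by rewrite ge_min lexx.
have dK : d * K <= d0 by rewrite -ler_pdivlMr// ge_min lexx orbT.
exists d => // z zb.
have ub i : `|usubmx z i 0| <= d by have := zb (lshift n i); rewrite !mxE subr0.
have vb i : `|dsubmx z i 0| <= d by have := zb (rshift n i); rewrite !mxE subr0.
have Hi := cintegrable_phase (dsubmx z) (cintegrable_wigner (usubmx z) inL2_cube1).
have Re_wigner : complex.Re (wigner cube1 z) =
    \int[leb]_y complex.Re (ambiguity wigner_mx cube1 (usubmx z) y *
      expi (- (2 * pi * dotcV (dsubmx z) y))) by rewrite wignerE.
move: (usubmx z) (dsubmx z) ub vb Hi Re_wigner => u v ub vb Hi Re_wigner.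
have theta (y : Rn) : (forall i, `|y i 0| <= 2) -> 2^-1 <= cos (- (2 * pi * dotcV v y)).
  move=> yb; apply: Hcos; rewrite normrN.
  have dot : `|dotcV v y| <= n%:R * (2 * d).
    rewrite /dotcV (le_trans (ler_norm_sum _ _ _))//.
    rewrite (@le_trans _ _ (\sum_(i < n) 2 * d))//.
      by apply: ler_sum => i _; rewrite normrM mulrC ler_pM.
    by rewrite sumr_const card_ord -[leLHS]mulr_natl.
  rewrite normrM gtr0_norm ?mulr_gt0 ?pi_gt0//.
  apply: le_trans dK.
  apply: (@le_trans _ _ (2 * pi * (n%:R * (2 * d)))).
    by rewrite ler_pM2l// mulr_gt0 ?pi_gt0.
  rewrite /K -natr1; have := pi_gt0 R; move: (pi) => P P0.
  have : 0 <= P * d by rewrite mulr_ge0// ltW.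
  by nra.
have Re_lb : 2^-1 * 2 ^+ n <= complex.Re (wigner cube1 z).
  rewrite Re_wigner.
  have indi : leb.-integrable setT (fun y => (\1_(cube 1) y : R)%:E).
    apply/integrableP; split.
      by apply/measurable_EFinP; apply: measurable_indic; exact: measurable_cube.
    under eq_integral do rewrite gee0_abs ?lee_fin//.
    rewrite integral_indic ?setIT//; last exact: measurable_cube.
    apply: le_lt_trans (ltry ((2 * 1%:R) ^+ n)).
    by rewrite le_eqVlt; apply/orP; left; apply/eqP; exact: cube_measure.
  have -> : 2^-1 * 2 ^+ n = \int[leb]_y (2^-1 * \1_(cube 1) y).
    rewrite RintegralZl//; congr (_ * _).
    rewrite /Rintegral integral_indic ?setIT//; last exact: measurable_cube.
    by rewrite [X in fine X]cube_measure mulr1.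
  apply: le_Rintegral => //.
  - exact: (integrableZl measurableT 2^-1 indi).
  - by case: Hi.
  move=> y _; rewrite ReM.
  have -> : ambiguity wigner_mx cube1 u y =
      (\1_(cube 1) (u + 2^-1 *: y) * \1_(cube 1) (u - 2^-1 *: y))%:C%C.
    rewrite /ambiguity /wigner_mx block_mxKul block_mxKur block_mxKdl block_mxKdr.
    rewrite !mul1mx !mul_scalar_mx scaleNr cube1_real /cube1.
    by rewrite -rmorphM.
  rewrite /= mul0r subr0.
  (* Since y is the difference of u + y/2 and u - y/2, it satisfies |y_i| <= 2 whenever both lie in
     the unit cube. *)
  have [yb|yb] := pselect (forall i, `|y i 0| <= 2); last first.
    have -> : \1_(cube 1) y = 0 :> R.
      rewrite indicE memNset// => y1; apply: yb => i.
      by rewrite (le_trans (y1 i))// ler_nat.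
    rewrite mulr0.
    have -> : \1_(cube 1) (u + 2^-1 *: y) * \1_(cube 1) (u - 2^-1 *: y) = 0 :> R;
      last by rewrite mul0r.
    rewrite !indicE -natrM mulnb; case: andP => //= -[].
    rewrite !inE => h1 h2; exfalso; apply: yb => i.
    have := h1 i; have := h2 i; rewrite !mxE.
    by rewrite !ler_norml => /andP[a1 a2] /andP[a3 a4]; apply/andP; split; lra.
  have c0 := theta y yb.
  have [y1|y1] := pselect (cube 1 y).
    rewrite !indicE !mem_set ?mulr1 ?mul1r//.
      move=> i; rewrite !mxE; have := y1 i; have := ub i.
      by rewrite !ler_norml => /andP[a1 a2] /andP[a3 a4]; apply/andP; split; lra.
    move=> i; rewrite !mxE; have := y1 i; have := ub i.
    by rewrite !ler_norml => /andP[a1 a2] /andP[a3 a4]; apply/andP; split; lra.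
  rewrite [X in 2^-1 * X]indicE memNset// mulr0 mulr_ge0 ?mulr_ge0//.
  by rewrite (le_trans _ c0).
have Re_gt0 : 0 < complex.Re (wigner cube1 z).
  by apply: lt_le_trans Re_lb; rewrite mulr_gt0 ?exprn_gt0.
by rewrite ltr_wpDr ?sqr_ge0// exprn_gt0.
Qed.

Let g (z : R2n) := sqnormc (wigner cube1 z).

Lemma ae_cV_box_false m (P : 'cV[R]_m -> Prop) (c : 'cV[R]_m) r : 0 < r ->
  {ae lebesgue_cV m, forall z, P z} -> (forall z, cV_box c r z -> ~ P z) -> False.
Proof.
move=> r0 [N [mN N0 PN]] NP.
have : (lebesgue_cV m (cV_box c r) <= lebesgue_cV m N)%E.
  apply: le_measure; rewrite ?inE//; first exact: measurable_cV_box.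
  by move=> z zb; apply: PN => /= Pz; exact: (NP z).
rewrite [X in (X <= _)%E](lebesgue_cV_box c (ltW r0)) [X in (_ <= X)%E]N0.
by rewrite lee_fin leNgt exprn_gt0// mulr_gt0.
Qed.

Lemma wigner_cube1_invariant_ae0 (l : R2n -> R) (M : 'M[R]_(n + n)) (c : R2n) i :
  `|\det M| = 1 -> measurable_fun setT l ->
  (forall z, (M *m z + c) i 0 = z i 0 + l z) ->
  (forall z, l (M *m z + c) = l z) ->
  {ae leb2, forall z, g (M *m z + c) = g z} ->
  {ae leb2, forall z, l z != 0 -> g z = 0}.
Proof.
move=> detM ml Ti lT gT.
apply: (integrable_invariant_ae0 detM _ _ _ ml Ti lT gT).
- exact: measurable_sqnormc (cmeasurable_wigner cmeasurable_cube1).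
- by move=> z; exact: sqnormc_ge0.
- exact: sqL2norm_wigner inL2_cube1.
Qed.

(** A nonzero coordinate of w is a constant displacement l, so g would vanish almost everywhere,
    against its positivity near 0. *)
Lemma wigner_cube1_no_period (w : R2n) :
  {ae leb2, forall z, g (1%:M *m z + w) = g z} -> w = 0.
Proof.
move=> gw; apply/colP => i; rewrite mxE; apply/eqP/negPn/negP => wi.
have H := @wigner_cube1_invariant_ae0 (fun=> w i 0) 1%:M w i.
have [d d0 gd] := wigner_cube1_gt0.
apply: (ae_cV_box_false (c := 0) d0 (H _ _ _ _ gw)).
- by rewrite det1 normr1.
- exact: measurable_cst.
- by move=> z; rewrite mul1mx mxE.
- by [].
by move=> z zb /(_ wi) gz; have := gd z zb; rewrite -/(g z) gz ltxx.
Qed.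

(** The shear displaces the i-th frequency by the linear form (L x)_i and fixes x, hence the form.
    If L i j <> 0, g would vanish almost everywhere off a hyperplane; the contradiction needs a box
    near 0 that avoids this hyperplane. *)
Lemma wigner_cube1_no_shear (L : 'M[R]_n) :
  {ae leb2, forall z, g (block_mx 1%:M 0 L 1%:M *m z) = g z} -> L = 0.
Proof.
move=> gL; apply/matrixP => i j; rewrite mxE; apply/eqP/negPn/negP => Lij.
set M := block_mx _ _ _ _ in gL.
have ME z : M *m z = col_mx (usubmx z) (L *m usubmx z + dsubmx z).
  by rewrite -{1}[z]vsubmxK mul_block_col !mul1mx mul0mx addr0.
pose l (z : R2n) : R := (L *m usubmx z) i 0.
have gL' : {ae leb2, forall z, g (M *m z + 0) = g z}.
  by apply: filterS gL => z; rewrite addr0.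
have ml : measurable_fun setT l.
  apply: measurable_cV_entry; apply: measurable_cV_mul.
  exact: measurable_cV_usubmx.
have H := @wigner_cube1_invariant_ae0 l M 0 (rshift n i) _ ml _ _ gL'.
have [d d0 gd] := wigner_cube1_gt0.
(* Moving from 0 by d / 2 along the j-th position axis gives [l c] = (d / 2) L i j, which is
   nonzero. *)
pose c : R2n := col_mx ((d / 2) *: delta_mx j 0) 0.
pose K := \sum_k `|L i k|.
have K0 : 0 <= K by apply: sumr_ge0.
have lc : l c = d / 2 * L i j.
  by rewrite /l /c col_mxKu -scalemxAr mxE -colE mxE.
have lc0 : 0 < `|l c| by rewrite normr_gt0 lc mulf_neq0// gt_eqF// divr_gt0.
(* The first bound keeps the box inside the region of positivity. The second gives K r < |l c|, with
   K the l^1 norm of row i of L, so l has no zero in the box; adding 1 to K makes this strict and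
   avoids division by 0. *)
pose r := Num.min (d / 2) (`|l c| / (K + 1)).
have r0 : 0 < r by rewrite lt_min !divr_gt0// ltr_wpDl.
apply: (ae_cV_box_false (c := c) r0 (H _ _ _)).
- by rewrite /M det_lblock !det1 mulr1 normr1.
- by move=> z; rewrite addr0 ME col_mxEd mxE addrC /l mxE.
- by move=> z; rewrite addr0 ME /l col_mxKu.
move=> z zb.
have rd : r <= d / 2 by rewrite ge_min lexx.
have zd : cV_box 0 d z.
  move=> k; rewrite mxE subr0.
  have cd : `|c k 0| <= d / 2.
    rewrite /c; case: (split_ordP k) => k' ->.
      rewrite col_mxEu !mxE; case: (_ == _); rewrite /= ?mulr1 ?mulr0 ?normr0 ?gtr0_norm//;
        by rewrite ?divr_gt0// ?divr_ge0// ltW.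
    by rewrite col_mxEd mxE normr0 divr_ge0// ltW.
  have := zb k; move: rd cd; rewrite !ler_norml => rd /andP[? ?] /andP[? ?].
  by apply/andP; split; lra.
have lz : l z != 0.
  have bnd : `|l z - l c| <= K * r.
    rewrite /l !mxE -sumrB mulr_suml (le_trans (ler_norm_sum _ _ _))//.
    apply: ler_sum => k _; rewrite -mulrBr normrM ler_wpM2l//.
    by have := zb (lshift n k); rewrite !mxE.
  apply/eqP => lz0; move: bnd; rewrite lz0 sub0r normrN => bnd.
  have rK : r * (K + 1) <= `|l c|.
    by rewrite -ler_pdivlMr ?ltr_wpDl// ge_min lexx orbT.
  by move: bnd rK r0; nra.
by move=> /(_ lz) gz; have := gd z zd; rewrite -/(g z) gz ltxx.
Qed.

End cube_indicator.

(** * Vanishing of B1 and of A2 *)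

Section block_structure.
Context {R : realType} {n : nat}.
Local Notation C := (R[i]).
Local Notation Rn := ('cV[R]_n).
Local Notation R2n := ('cV[R]_(n + n)).
Local Notation leb := (lebesgue_cV (R := R) n).
Local Notation leb2 := (lebesgue_cV (R := R) (n + n)).
Variables S1 S2 : 'M[R]_(n + n).
Hypothesis hD : D12 S1 S2 \in unitmx.
Let D := D12 S1 S2.
Let g (z : R2n) := sqnormc (wigner (@cube1 R n) z).
Let W := wigner_theta S1 S2.

Let de : R := `|\det D|^-1.

Let de0 : de ^+ 2 != 0.
Proof.
by rewrite expf_neq0// invr_eq0 normr_eq0; move: hD; rewrite unitmxE unitfE.
Qed.

Let sqnormc_W f z : sqnormc (W f z) = de ^+ 2 * sqnormc (wigner f (invmx D *m z)).
Proof. by rewrite /W /wigner_theta sqnormcM sqnormc_real. Qed.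

(** A relation between moduli of truncations passes to the moduli of B_A, then to those of W_theta
    because the same N multiplies both sides, and finally to those of W, the affine map being
    conjugated by D. The only factor cancelled is |det D|^-2, which is nonzero. *)
Lemma ae_sqnormc_transport (A : 'M[R]_(n + n)) (N : R) (f f' : Rn -> C)
    (F F' : R2n -> C) (M : 'M[R]_(n + n)) (c : R2n) : M \in unitmx ->
  cmeasurable f -> cmeasurable f' -> is_BA A f f F -> is_BA A f' f' F' ->
  {ae leb2, forall z, W f z = N%:C%C * F z} ->
  {ae leb2, forall z, W f' z = N%:C%C * F' z} ->
  (forall k z, sqnormc (BA_truncated A f' f' k z) =
               sqnormc (BA_truncated A f f k (M *m z + c))) ->
  {ae leb2, forall z, sqnormc (wigner f' z) =
                      sqnormc (wigner f (invmx D *m (M *m (D *m z) + c)))}.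
Proof.
move=> Mu mf mf' [mF aF] [mF' aF'] WF WF' E.
have mBA h k : cmeasurable h -> cmeasurable (BA_truncated A h h k).
  move=> mh; rewrite (_ : BA_truncated A h h k = pft (cut (cube k) (ambiguity A h))).
    apply: cmeasurable_pft; apply: joint_cmeasurable_cut.
      exact: measurable_cube.
    exact: joint_cmeasurable_ambiguity.
  by apply/funext => z; exact: BA_truncatedE.
have FF' := sqnormc_L2_limits_ae Mu (fun k => mBA f k mf) (fun k => mBA f' k mf')
  mF mF' E aF aF'.
have WFM := ae_cV_affine c Mu WF.
have ae : {ae leb2, forall z, sqnormc (W f' z) = sqnormc (W f (M *m z + c))}.
  apply: filterS3 FF' WF' WFM => z e1 e2 e3.
  by rewrite e2 e3 !sqnormcM e1.
have := ae_cV_affine 0 (hD : D \in unitmx) ae; apply: filterS => z.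
rewrite addr0 => Wz; apply: (mulfI de0).
have := sqnormc_W f' (D *m z); rewrite (mulKmx (hD : D \in unitmx)) => <-.
by rewrite Wz; exact: sqnormc_W.
Qed.

Lemma linear_perturbation_ursubmx0 : is_linear_perturbation W -> ursubmx S1 = 0.
Proof.
move=> [A [_ [N H]]].
have f2 := @inL2_cube1 R n.
apply/matrixP => i j; rewrite mxE.
pose eta : Rn := delta_mx j 0.
have [F BF WF] := H _ f2.
have [F' BF' WF'] := H _ (inL2_modulate eta f2).
pose c : R2n := col_mx 0 (- (ambiguity_shift A *m eta)).
have := ae_sqnormc_transport (unitmx1 R _) (@cmeasurable_cube1 R n)
  (cmeasurable_modulate eta (@cmeasurable_cube1 R n)) BF BF' WF WF'
  (c := c) (fun k z => sqnormc_BA_modulate A eta k z (@cmeasurable_cube1 R n)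
    (@cube1_le1 R n)).
move=> /(ae_cV_affine (col_mx 0 eta) (unitmx1 R _)) ae.
(* Evaluation at z + (0, eta) undoes the translation of |W f| caused by the modulation, so that only
   translates of the same function g are compared. *)
have /wigner_cube1_no_period w0 : {ae leb2, forall z,
    g (1%:M *m z + (col_mx 0 eta + invmx D *m c)) = g z}.
  apply: filterS ae => z; rewrite (sqnormc_wigner_modulate eta _ f2) !mul1mx.
  rewrite -addrA add_col_mx addr0 subrr col_mx0 addr0 => E.
  rewrite /g E (mulmxDr (invmx D)) (mulKmx hD); congr (sqnormc (wigner _ _)).
  by rewrite addrA.
have : D *m col_mx 0 eta = - c.
  apply/eqP; rewrite -addr_eq0 -[c](mulKVmx hD) -mulmxDr w0 mulmx0//.
rewrite /D /D12 mul_block_col !mulmx0 !add0r /c opp_col_mx oppr0 opprK.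
move/eq_col_mx => [E _].
have := congr1 (fun v : Rn => v i 0) E.
by rewrite /eta -colE !mxE.
Qed.

Lemma linear_perturbation_ulsubmx0 : is_linear_perturbation W -> ulsubmx S2 = 0.
Proof.
move=> lp; have B10 := linear_perturbation_ursubmx0 lp.
move: lp => [A [_ [N H]]].
have f2 := @inL2_cube1 R n.
have [F BF WF] := H _ f2.
pose A1 := ulsubmx S1; pose A2 := ulsubmx S2; pose B2 := ursubmx S2.
have DE : D = block_mx A1 0 A2 B2 by rewrite /D /D12 B10.
have [A1u B2u] : A1 \in unitmx /\ B2 \in unitmx.
  by have := hD; rewrite -/D DE unitmxE det_lblock unitrM => /andP[].
have flip_unit : (frequency_flip : 'M[R]_(n + n)) \in unitmx.
  have : frequency_flip *m frequency_flip = 1%:M :> 'M[R]_(n + n).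
    rewrite /frequency_flip mulmx_block !mulmx0 !mul0mx mulmx1 mulmxN mulNmx mulmx1.
    by rewrite opprK !addr0 !add0r -scalar_mx_block.
  by case/mulmx1_unit.
have := ae_sqnormc_transport flip_unit (@cmeasurable_cube1 R n)
  (@cmeasurable_cube1 R n) BF BF WF WF (c := 0).
have E k z : sqnormc (BA_truncated A (@cube1 R n) (@cube1 R n) k z) =
    sqnormc (BA_truncated A (@cube1 R n) (@cube1 R n) k (frequency_flip *m z + 0)).
  rewrite addr0 sqnormc_BA_flip//.
  - exact: cmeasurable_cube1.
  - exact: cube1_le1.
  - exact: cube1_real.
move=> /(_ E) ae.
pose L := invmx B2 *m A2.
(* With M the shear of parameter 2 L and sigma = [frequency_flip], D sigma M = sigma D: the lower
   left block of the left side is A2 - 2 B2 L = - A2, which explains the factor 2. Evenness of g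
   removes the remaining sigma. *)
have L0 : 2 *: L = 0.
  apply: wigner_cube1_no_shear; apply: filterS ae => z; rewrite addr0 => ->.
  rewrite -[LHS](sqnormc_wigner_flip _ f2 (@cube1_real R n)).
  congr (sqnormc (wigner _ _)).
  apply: (can_inj (mulKmx hD)); rewrite mulKVmx// -/D !mulmxA; congr (_ *m z).
  rewrite DE /frequency_flip !mulmx_block.
  rewrite !(mul0mx, mulmx0, mul1mx, mulmx1, add0r, addr0, mulmxN, mulNmx).
  rewrite -scalemxAr /L mulKVmx//; congr block_mx.
  by rewrite scaler_nat mulr2n opprD addNKr.
have : B2 *m (2 *: L) = 0 by rewrite L0 mulmx0.
rewrite -scalemxAr mulKVmx// => /eqP.
by rewrite scaler_eq0 pnatr_eq0 /= => /eqP.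
Qed.

End block_structure.

(** * The remaining blocks, from the symplectic relations *)

Section symplectic_blocks.
Context {R : realType} {n : nat}.

Lemma symplectic_block (A B C D : 'M[R]_n) : symplectic (block_mx A B C D) ->
  [/\ A^T *m C = C^T *m A, A^T *m D - C^T *m B = 1%:M & B^T *m D = D^T *m B].
Proof.
rewrite /symplectic /Jmx tr_block_mx !mulmx_block.
rewrite !(mul0mx, mulmx0, mul1mx, mulmx1, add0r, addr0, mulmxN, mulNmx).
move=> /eq_block_mx[e1 e2 _ e3]; split.
- by apply/eqP; rewrite -subr_eq0 addrC e1.
- by rewrite addrC.
- by apply/eqP; rewrite -subr_eq0 addrC e3.
Qed.

(** With B1 = 0 and A2 = 0 the mixed relations become A1^T D1 = 1 and -C2^T B2 = 1. They make A1 and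
    B2 invertible and determine D1 and C2; the other relations are the two symmetry conditions. *)
Lemma perturbation_form_of_blocks (S1 S2 : 'M[R]_(n + n)) :
  symplectic S1 -> symplectic S2 -> ursubmx S1 = 0 -> ulsubmx S2 = 0 ->
  exists A11 A22 C1 D2 : 'M[R]_n, perturbation_form S1 S2 A11 A22 C1 D2.
Proof.
rewrite -[S1]submxK -[S2]submxK !(block_mxKul, block_mxKur).
move=> + + B10 A20; rewrite B10 A20.
move: (ulsubmx S1) (dlsubmx S1) (drsubmx S1) => A1 C1 D1.
move: (ursubmx S2) (dlsubmx S2) (drsubmx S2) => B2 C2 D2.
move=> /symplectic_block[sAC AD _] /symplectic_block[_ BC sBD].
rewrite mulmx0 subr0 in AD; rewrite trmx0 mul0mx sub0r in BC.
have [A1Tu _] := mulmx1_unit AD.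
have A1u : A1 \in unitmx by rewrite -unitmx_tr.
have BC' : B2^T *m C2 = - 1%:M.
  by rewrite -[LHS]trmxK trmx_mul trmxK -[_ *m _]opprK BC linearN/= trmx1.
(* Forced by the required form B2 = -2 A22^T. *)
pose A22 : 'M[R]_n := - 2^-1 *: B2^T.
have A22C : A22 *m (2 *: C2) = 1%:M.
  rewrite /A22 -scalemxAl -scalemxAr scalerA BC' scalerN -scaleNr mulNr opprK.
  by rewrite mulVf ?scale1r ?pnatr_eq0.
have [A22u _] := mulmx1_unit A22C.
have A22V : invmx A22 = 2 *: C2.
  by rewrite -[RHS](mulKmx A22u) A22C mulmx1.
exists (invmx A1), A22, C1, D2; split.
- by rewrite unitmx_inv A1u A22u.
- by rewrite invmxK trmx_mul trmxK sAC.
- by rewrite /A22 -scalemxAl linearZ/= trmx_mul trmxK sBD.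
- by rewrite invmxK trmx_inv -[X in block_mx _ _ _ X = _](mulKmx A1Tu) AD mulmx1.
- rewrite A22V scalerA mulVf ?pnatr_eq0// scale1r /A22 linearZ/= trmxK scalerA.
  by rewrite mulrNN divff ?pnatr_eq0// scale1r.
Qed.

End symplectic_blocks.

Theorem theorem18 (R : realType) (n : nat) (S1 S2 : 'M[R]_(n + n))
    (hS1 : symplectic S1) (hS2 : symplectic S2)
    (hD : D12 S1 S2 \in unitmx) :
  (is_linear_perturbation (wigner_theta S1 S2) <->
   exists A11 A22 C1 D2 : 'M[R]_n, perturbation_form S1 S2 A11 A22 C1 D2) /\
  (forall A11 A22 C1 D2 : 'M[R]_n, perturbation_form S1 S2 A11 A22 C1 D2 ->
   linear_perturbation_by (wigner_theta S1 S2)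
     (block_mx A11 (- A22) A11 A22)).
Proof.
split; last exact: wigner_theta_perturbation.
split=> [lp|[A11 [A22 [C1 [D2 form]]]]].
  apply: perturbation_form_of_blocks => //.
    exact: linear_perturbation_ursubmx0 lp.
  exact: linear_perturbation_ulsubmx0 lp.
by exists (block_mx A11 (- A22) A11 A22); exact: wigner_theta_perturbation form.
Qed.
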